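(* For all integers $n\ge 0$, $$f(1250n+125)\equiv 0 \pmod{125}\quad\text{and}\quad f(1250n+1125)\equiv 0 \pmod{125}.$$
   Context: For $n\ge 0$, let $f(n)$ denote the number of 1-shell totally symmetric plane partitions of weight $n$. Equivalently, $f$ is defined by the generating function $$\sum_{n\ge 0}f(n)q^n=1+\sum_{n\ge 1}q^{3n-2}\prod_{i=0}^{n-2}\left(1+q^{6i+3}\right).$$ (A plane partition is an array of nonnegative integers $\pi_{i,j}$ weakly decreasing in both indices; it is totally symmetric if invariant under all permutations of the three axes; it is 1-shell if its first row/column is a self-conjugate partition and all other nonzero entries equal 1; its weight is the sum of its entries.) *)

(* Defs.v *)
From mathcomp Require Import all_boot all_order all_algebra.

Set Implicit Arguments.
Unset Strict Implicit.
Unset Printing Implicit Defensive.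

(* A plane partition of weight [n] has at most [n] nonzero rows and columns
   and its entries are at most [n], so that those of weight [n] are exactly
   the ones encoded by the matrices below.  Indices start at 0. *)
Notation pp_array n := 'M['I_n.+1]_n.

Section PlanePartitions.

Variable n : nat.
Implicit Types (A : pp_array n) (i j k : 'I_n).

Definition plane_partition A : bool :=
  [forall i : 'I_n, forall i' : 'I_n, forall j : 'I_n, (i <= i') ==>
     (A i' j <= A i j)] &&
  [forall i : 'I_n, forall j : 'I_n, forall j' : 'I_n, (j <= j') ==>
     (A i j' <= A i j)].

Definition weight A : nat := \sum_(i < n) \sum_(j < n) A i j.

(* The unit cube at (i, j, k) lies in the three-dimensional diagram of [A]. *)
Definition cube A i j k : bool := k < A i j.

Definition totally_symmetric A : bool :=
  [forall i : 'I_n, forall j : 'I_n, forall k : 'I_n,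
    [&& cube A j i k == cube A i j k, cube A i k j == cube A i j k,
        cube A k j i == cube A i j k, cube A j k i == cube A i j k
      & cube A k i j == cube A i j k]].

(* The j-th part of the conjugate partition is the number of parts of [p]
   that exceed j. *)
Definition self_conjugate (p : 'I_n -> 'I_n.+1) : bool :=
  [forall j : 'I_n, p j == #|[set k : 'I_n | j < p k]| :> nat].

Definition one_shell A : bool :=
  [&& [forall i : 'I_n, (i == 0 :> nat) ==> self_conjugate (fun j => A i j)],
      [forall j : 'I_n, (j == 0 :> nat) ==> self_conjugate (fun i => A i j)]
    & [forall i : 'I_n, forall j : 'I_n,
        [&& 0 < i, 0 < j & A i j != 0 :> nat] ==> (A i j == 1 :> nat)]].

End PlanePartitions.

Definition f (n : nat) : nat :=
  #|[set A : pp_array n | [&& plane_partition A, totally_symmetric A,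
                              one_shell A & weight A == n]]|.

(* Main.v *)
Require Import Defs.
From mathcomp Require Import all_boot all_order all_algebra.
From HB Require Import structures.
From mathcomp Require Import boolp zify ring.

(* Write E_k for the product of the 1 - q^(k i), and phi for phi(-q) = E_1^2 / E_2.
   A 1-shell totally symmetric plane partition is determined by the self-conjugate
   partition formed by its first row, that is by the set of the arm lengths of the
   principal hooks of that partition.  Counting these sets by their largest element
   gives f(3 s + 1) = a(s) with sum_s a(s) q^s = sum_n q^n (-q; q^2)_n, and f(N) = 0
   for the other N > 0.

   This series is nu(-q) for the third order mock theta function nu, and
   nu(q) + nu(-q) = 2 E_4^3 / E_2^2, so that f(6 m + 1) is the m-th coefficient of
   E_2^3 / E_1^2 = E_2^2 / phi.

   Let U_r extract the coefficients of index r modulo 5.  The 5-dissections of E_1 and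
   phi and the relation phi E_2 = E_1^2 express all the components involved through
   two independent parameters.  It follows that phi is a root of a quintic polynomial
   whose coefficients are series in q^5, explicit in terms of phi(-q^5) and phi(-q^25),
   and U_4 (E_2^2 phi^j), U_0 (phi^j) obey the corresponding recurrences in j.  With
   a = phi(-q^5) and b = E_10, this gives
     U_4 (E_2^2 / phi) = 5 a b^2 / phi^2,
     U_4 U_0 U_4 (E_2^2 / phi) = 25 b^2 (a^3 / phi^4 - 2 a / phi^2)  modulo 125,
   and the components of index 1 and 4 modulo 5 of the last bracket vanish modulo 5. *)

Set Implicit Arguments.
Unset Strict Implicit.
Unset Printing Implicit Defensive.
Import Order.TTheory GRing.Theory Num.Theory.

(** * Formal power series with integer coefficients *)

Section PowerSeries.
Local Open Scope ring_scope.

Record fps := Fps { cf : nat -> int }.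

Lemma fpsP (f g : fps) : (forall n, cf f n = cf g n) -> f = g.
Proof. by case: f g => f [g] /= /funext ->. Qed.

HB.instance Definition _ := gen_eqMixin fps.
HB.instance Definition _ := gen_choiceMixin fps.

Definition fps_trunc N (f : fps) : {poly int} := \poly_(i < N) cf f i.

Lemma coef_trunc N f i : (fps_trunc N f)`_i = if (i < N)%N then cf f i else 0.
Proof. by rewrite coef_poly. Qed.

Definition fps_zero := Fps (fun _ => 0).
Definition fps_opp f := Fps (fun n => - cf f n).
Definition fps_add f g := Fps (fun n => cf f n + cf g n).
Definition fps_one := Fps (fun n => (n == 0%N)%:R).
(** The polynomial form lets the ring laws be inherited from [{poly int}]. *)
Definition fps_mul f g := Fps (fun n => (fps_trunc n.+1 f * fps_trunc n.+1 g)`_n).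

Lemma eq_coefMl (p p' r : {poly int}) n :
  (forall i, (i <= n)%N -> p`_i = p'`_i) -> (p * r)`_n = (p' * r)`_n.
Proof.
move=> e; rewrite !coefM; apply: eq_bigr => i _.
by rewrite e // -ltnS.
Qed.

(** Terms of degree above n do not reach coefficient n, so one common truncation N can serve for all
    factors of a product. *)
Lemma cf_mulE N f g n : (n < N)%N ->
  cf (fps_mul f g) n = (fps_trunc N f * fps_trunc N g)`_n.
Proof.
move=> nN /=.
have e h i : (i <= n)%N -> (fps_trunc n.+1 h)`_i = (fps_trunc N h)`_i.
  by move=> le_in; rewrite !coef_trunc ltnS le_in (leq_ltn_trans le_in nN).
rewrite (eq_coefMl _ (e f)) mulrC (eq_coefMl _ (e g)); exact: (congr1 (fun p : {poly int} => p`_n) (mulrC _ _)).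
Qed.

Lemma fps_addA : associative fps_add.
Proof. by move=> f g h; apply: fpsP => n /=; rewrite addrA. Qed.
Lemma fps_addC : commutative fps_add.
Proof. by move=> f g; apply: fpsP => n /=; rewrite addrC. Qed.
Lemma fps_add0 : left_id fps_zero fps_add.
Proof. by move=> f; apply: fpsP => n /=; rewrite add0r. Qed.
Lemma fps_addN : left_inverse fps_zero fps_opp fps_add.
Proof. by move=> f; apply: fpsP => n /=; rewrite addNr. Qed.

HB.instance Definition _ :=
  GRing.isZmodule.Build fps fps_addA fps_addC fps_add0 fps_addN.

Lemma fps_mulC : commutative fps_mul.
Proof. by move=> f g; apply: fpsP => n /=; rewrite mulrC. Qed.

Lemma trunc_mul N f g i : (i < N)%N ->
  (fps_trunc N (fps_mul f g))`_i = (fps_trunc N f * fps_trunc N g)`_i.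
Proof. by move=> iN; rewrite coef_trunc iN (cf_mulE _ _ iN). Qed.

Lemma fps_mulA : associative fps_mul.
Proof.
move=> f g h; apply: fpsP => n.
rewrite !(@cf_mulE n.+1) // mulrC.
have e f' g' i : (i <= n)%N -> (fps_trunc n.+1 (fps_mul f' g'))`_i
   = (fps_trunc n.+1 f' * fps_trunc n.+1 g')`_i by move=> ?; apply: trunc_mul.
by rewrite (eq_coefMl _ (e g h)) (eq_coefMl _ (e f g)) mulrC mulrA.
Qed.

Lemma fps_mul1 : left_id fps_one fps_mul.
Proof.
move=> f; apply: fpsP => n; rewrite /=.
have -> : fps_trunc n.+1 fps_one = 1.
  by apply/polyP => i; rewrite coef_trunc coef1 /=; case: i => // i; case: ifP.
by rewrite mul1r coef_trunc ltnSn.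
Qed.

Lemma fps_mulD : left_distributive fps_mul fps_add.
Proof.
move=> f g h; apply: fpsP => n /=.
rewrite -coefD -mulrDl; congr (nth 0 (polyseq (_ * _)) _).
by apply/polyP => i; rewrite coefD !coef_trunc /=; case: ifP => // _; rewrite addr0.
Qed.

Lemma fps_1neq0 : fps_one != fps_zero.
Proof. by apply/eqP => /(congr1 (cf^~ 0%N)). Qed.

HB.instance Definition _ := GRing.Zmodule_isComNzRing.Build fps
  fps_mulA fps_mulC fps_mul1 fps_mulD fps_1neq0.

Lemma cfD f g n : cf (f + g) n = cf f n + cf g n. Proof. by []. Qed.
Lemma cfN f n : cf (- f) n = - cf f n. Proof. by []. Qed.
Lemma cfB f g n : cf (f - g) n = cf f n - cf g n. Proof. by []. Qed.
Lemma cf0 n : cf 0 n = 0. Proof. by []. Qed.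
Lemma cf1 n : cf 1 n = (n == 0%N)%:R. Proof. by []. Qed.
Lemma cfM f g n : cf (f * g) n = \sum_(i < n.+1) cf f i * cf g (n - i).
Proof.
rewrite /GRing.mul /= coefM; apply: eq_bigr => i _.
by rewrite !coef_trunc ltn_ord ltnS leq_subr.
Qed.
Lemma cf_sum I (r : seq I) (P : pred I) (F : I -> fps) n :
  cf (\sum_(i <- r | P i) F i) n = \sum_(i <- r | P i) cf (F i) n.
Proof. by elim/big_rec2: _ => // i x y _ <-. Qed.
Lemma cfMn f k n : cf (f *+ k) n = cf f n *+ k.
Proof. by elim: k => // k IH; rewrite !mulrS cfD IH. Qed.

Definition q : fps := Fps (fun n => (n == 1%N)%:R).

Lemma cf_qM f n : cf (q * f) n = if n is m.+1 then cf f m else 0.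
Proof.
rewrite cfM; case: n => [|n]; first by rewrite big_ord1 mul0r.
rewrite (bigD1 (Ordinal (isT : 1 < n.+2)%N)) //= mul1r subn1 big1 ?addr0 //.
by move=> i ne; rewrite /= (_ : (i == 1%N :> nat) = false) ?mul0r //; apply/negbTE.
Qed.

Lemma cf_qXM k f n : cf (q ^+ k * f) n = if (k <= n)%N then cf f (n - k) else 0.
Proof.
elim: k n => [|k IH] n; first by rewrite mul1r subn0.
by rewrite exprS -mulrA cf_qM; case: n => // n; rewrite IH ltnS subSS.
Qed.

Lemma cf_qX k n : cf (q ^+ k) n = (n == k)%:R.
Proof.
rewrite -[q ^+ k]mulr1 cf_qXM cf1; case: leqP => kn; last by rewrite ltn_eqF.
by rewrite subn_eq0 eqn_leq kn andbT.
Qed.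

(** * Truncation orders and infinite sums *)

Definition vanish N f := forall i, (i < N)%N -> cf f i = 0.

Lemma vanishW N M f : (M <= N)%N -> vanish N f -> vanish M f.
Proof. by move=> MN v i iM; apply: v; apply: leq_trans MN. Qed.
Lemma vanishD N f g : vanish N f -> vanish N g -> vanish N (f + g).
Proof. by move=> vf vg i iN; rewrite cfD vf ?vg. Qed.
Lemma vanishN N f : vanish N f -> vanish N (- f).
Proof. by move=> vf i iN; rewrite cfN vf ?oppr0. Qed.
Lemma vanishB N f g : vanish N f -> vanish N g -> vanish N (f - g).
Proof. by move=> vf vg; apply: vanishD => //; apply: vanishN. Qed.
Lemma vanishM N M f g : vanish N f -> vanish M g -> vanish (N + M)%N (f * g).
Proof.
move=> vf vg i iNM; rewrite cfM big1 // => j _.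
case: (ltnP j N) => jN; first by rewrite vf ?mul0r.
by rewrite vg ?mulr0 //; have := ltn_ord j; lia.
Qed.
Lemma vanishMl N f g : vanish N g -> vanish N (f * g).
Proof. by apply: (@vanishM 0). Qed.
Lemma vanishMr N f g : vanish N f -> vanish N (f * g).
Proof. by rewrite mulrC; apply: vanishMl. Qed.
Lemma vanishq k : vanish k (q ^+ k).
Proof. by move=> i ik; rewrite cf_qX ltn_eqF. Qed.
Lemma vanish_sum N I (r : seq I) (P : pred I) (F : I -> fps) :
  (forall i, P i -> vanish N (F i)) -> vanish N (\sum_(i <- r | P i) F i).
Proof. by move=> vF; elim/big_ind: _ => // f g; apply: vanishD. Qed.
Lemma vanish_signM N k f : vanish N f -> vanish N ((-1) ^+ k * f).
Proof. exact: vanishMl. Qed.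

Lemma vanish_eq f g : (forall N, vanish N (f - g)) -> f = g.
Proof.
move=> v; apply: fpsP => n; apply/eqP; rewrite -subr_eq0 -cfB.
by rewrite (v n.+1).
Qed.

Definition summable (F : nat -> fps) := forall i, vanish i (F i).

(** For a [summable] family the cut at i <= n loses nothing, the later terms starting beyond q^n. *)
Definition fsum (F : nat -> fps) := Fps (fun n => \sum_(i < n.+1) cf (F i) n).

Lemma cf_fsum F N n : summable F -> (n < N)%N ->
  cf (fsum F) n = \sum_(i < N) cf (F i) n.
Proof.
move=> sF nN; rewrite /= (big_ord_widen _ (fun i => cf (F i) n) nN).
rewrite [RHS](bigID (fun i : 'I_N => (i < n.+1)%N)) /= [X in _ + X]big1 ?addr0 //.
by move=> i; rewrite -leqNgt => ni; apply: sF.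
Qed.

Lemma fsum_vanish F N : summable F -> vanish N (fsum F - \sum_(i < N) F i).
Proof. by move=> sF i iN; rewrite cfB (cf_fsum sF iN) cf_sum subrr. Qed.

Lemma eq_fsum F G : F =1 G -> fsum F = fsum G.
Proof. by move=> e; apply: fpsP => n /=; apply: eq_bigr => i _; rewrite e. Qed.

Lemma fsumD F G : fsum (fun i => F i + G i) = fsum F + fsum G.
Proof. by apply: fpsP => n /=; rewrite -big_split. Qed.

Lemma fsumN F : fsum (fun i => - F i) = - fsum F.
Proof. by apply: fpsP => n /=; rewrite -sumrN. Qed.

(** Both indices are cut at the same n, so this is an exchange of finite square sums. *)
Lemma fsum_exchange (F : nat -> nat -> fps) :
  fsum (fun i => fsum (F i)) = fsum (fun j => fsum (F^~ j)).
Proof. by apply: fpsP => n /=; rewrite exchange_big. Qed.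

Lemma fsumMl g F : summable F -> fsum (fun i => g * F i) = g * fsum F.
Proof.
move=> sF; apply: vanish_eq => N.
have sgF : summable (fun i => g * F i) by move=> i; apply: vanishMl.
have := vanishB (fsum_vanish (N := N) sgF) (vanishMl g (fsum_vanish (N := N) sF)).
rewrite -mulr_sumr; congr vanish; ring.
Qed.

Lemma fsum_recl F : summable F -> fsum F = F 0%N + fsum (fun i => F i.+1).
Proof.
move=> sF; apply: fpsP => n; rewrite cfD (cf_fsum sF (ltnW (ltnSn n.+1))).
by rewrite big_ord_recl.
Qed.

Lemma vanish_fsum N F : (forall i, vanish N (F i)) -> vanish N (fsum F).
Proof. by move=> vF i iN /=; rewrite big1 // => j _; apply: vF. Qed.

Lemma fsum_telescope (F G : nat -> fps) : summable G -> 
  (forall i, F i = G i - G i.+1) -> fsum F = G 0%N.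
Proof.
move=> sG e; apply: vanish_eq => N.
have sF : summable F.
  by move=> i; rewrite e; apply: vanishB => //; apply: vanishW (sG i.+1).
have e' : \sum_(i < N) F i = G 0%N - G N.
  under eq_bigr do rewrite e.
  elim: (N) => [|n IH]; first by rewrite big_ord0 subrr.
  by rewrite big_ord_recr /= IH; ring.
have := vanishB (fsum_vanish (N := N) sF) (sG N).
by rewrite e'; congr vanish; ring.
Qed.

(** Geometric series in 1 - f, whose i-th power has order at least i. *)
Lemma fps_inverse f : cf f 0 = 1 -> exists g, g * f = 1.
Proof.
move=> f0; have v i : vanish i ((1 - f) ^+ i).
  elim: i => [|i IH] //; rewrite exprS -add1n; apply: vanishM => //.
  by case=> // _; rewrite cfB f0 subrr.
exists (fsum (fun i => (1 - f) ^+ i)); rewrite mulrC -fsumMl //.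
by rewrite (@fsum_telescope _ (fun i => (1 - f) ^+ i)) // => i; rewrite exprS; ring.
Qed.

Definition fps_unit (f : fps) : bool := `[< exists g, g * f = 1 >].
Definition fps_inv (f : fps) : fps :=
  if pselect (exists g, g * f = 1) is left h then projT1 (cid h) else f.

Lemma fps_mulVf : {in fps_unit, left_inverse 1 fps_inv *%R}.
Proof.
move=> f /asboolP h; rewrite /fps_inv; case: pselect => // h'.
exact: (projT2 (cid h')).
Qed.
Lemma fps_unitP f g : g * f = 1 -> f \in fps_unit.
Proof. by move=> e; apply/asboolP; exists g. Qed.
Lemma fps_inv_out : {in [predC fps_unit], fps_inv =1 id}.
Proof.
move=> f /negP h; rewrite /fps_inv; case: pselect => // h'.
by case: h; apply/asboolP.
Qed.

HB.instance Definition _ := GRing.ComNzRing_hasMulInverse.Build fps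
  fps_mulVf fps_unitP fps_inv_out.

Lemma fps_unitE f : cf f 0 = 1 -> f \is a GRing.unit.
Proof. by move=> /fps_inverse h; apply/asboolP. Qed.

Lemma fps_neq0 f : f != 0 -> exists2 n, vanish n f & cf f n != 0.
Proof.
move=> fn0; have h : exists n, cf f n != 0.
  apply: contrapT => h; case/eqP: fn0; apply: fpsP => n; apply/eqP/negPn/negP => hn.
  by case: h; exists n.
case: (ex_minnP h) => n hn hmin; exists n => // i iN; apply/eqP/negPn/negP => /hmin; lia.
Qed.

(** The product of the two lowest terms survives. Integrality gives access to the fraction field,
    where the rational parametrisation below takes place. *)
Lemma fps_integral : GRing.integral_domain_axiom fps.
Proof.
move=> f g fg0; apply/norP => -[/fps_neq0[n vf fn] /fps_neq0[m vg gm]].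
have := congr1 (cf^~ (n + m)%N) fg0; rewrite cfM.
have nnm : (n < (n + m).+1)%N by rewrite ltnS leq_addr.
rewrite (bigD1 (Ordinal nnm)) //= big1 => [|i ne].
  by rewrite addr0 addKn => /eqP; rewrite mulf_eq0 (negbTE fn) (negbTE gm).
case: (ltngtP i n) => c; first by rewrite vf ?mul0r.
  by rewrite vg ?mulr0 //; have := ltn_ord i; lia.
by case/eqP: ne; apply: val_inj.
Qed.
HB.instance Definition _ := GRing.ComUnitRing_isIntegral.Build fps fps_integral.

End PowerSeries.

(** * Dilations and 5-dissections *)

Section Dilation.
Local Open Scope ring_scope.

(** The series f(q^d). *)
Definition dil d f := Fps (fun n => if (d %| n)%N then cf f (n %/ d)%N else 0).

Lemma cf_dil d f n : cf (dil d f) n = if (d %| n)%N then cf f (n %/ d)%N else 0.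
Proof. by []. Qed.

Lemma dilB d f g : dil d (f - g) = dil d f - dil d g.
Proof. by apply: fpsP => n /=; case: ifP => // _; rewrite subr0. Qed.

Lemma dil1 d : (0 < d)%N -> dil d 1 = 1.
Proof.
move=> d0; apply: fpsP => n; rewrite /=.
case: ifP => [/dvdnP[k ->]|]; first by rewrite mulnK // muln_eq0 (gtn_eqF d0) orbF.
by case: n => //; rewrite dvdn0.
Qed.

Lemma dil_trunc d f n : (0 < d)%N ->
  forall i, (i <= n)%N -> (fps_trunc n.+1 (dil d f))`_i = (fps_trunc n.+1 f \Po 'X^d)`_i.
Proof.
move=> d0 i le_in; rewrite coef_comp_poly_Xn // !coef_trunc !ltnS le_in /=.
by rewrite (leq_trans (leq_div _ _) le_in).
Qed.

(** On truncations a dilation is composition with ['X^d], which is multiplicative on polynomials. *)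
Lemma dilM d f g : (0 < d)%N -> dil d (f * g) = dil d f * dil d g.
Proof.
move=> d0; apply: fpsP => n.
rewrite [RHS](@cf_mulE n.+1) // (eq_coefMl _ (dil_trunc f d0)) [in RHS]mulrC.
rewrite (eq_coefMl _ (dil_trunc g d0)) [in RHS]mulrC -comp_polyM coef_comp_poly_Xn //.
rewrite cf_dil.
by case: ifP => // _; rewrite (@cf_mulE n.+1) // ltnS leq_div.
Qed.

Definition dil2 := dil 2.
Definition dil5 := dil 5.

Lemma cf_dil2 f n : cf (dil2 f) n = if (2 %| n)%N then cf f (n %/ 2)%N else 0.
Proof. by []. Qed.
Lemma cf_dil5 f n : cf (dil5 f) n = if (5 %| n)%N then cf f (n %/ 5)%N else 0.
Proof. by []. Qed.

Lemma dil2B : zmod_morphism (dil2). Proof. by move=> f g; apply: dilB. Qed.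
Lemma dil5B : zmod_morphism (dil5). Proof. by move=> f g; apply: dilB. Qed.
Lemma dil2M : monoid_morphism (dil2).
Proof. by split=> [|f g]; [apply: dil1 | apply: dilM]. Qed.
Lemma dil5M : monoid_morphism (dil5).
Proof. by split=> [|f g]; [apply: dil1 | apply: dilM]. Qed.
HB.instance Definition _ := GRing.isZmodMorphism.Build fps fps (dil2) dil2B.
HB.instance Definition _ := GRing.isMonoidMorphism.Build fps fps (dil2) dil2M.
HB.instance Definition _ := GRing.isZmodMorphism.Build fps fps (dil5) dil5B.
HB.instance Definition _ := GRing.isMonoidMorphism.Build fps fps (dil5) dil5M.

Lemma dil_q d : (0 < d)%N -> dil d q = q ^+ d.
Proof.
move=> d0; apply: fpsP => n; rewrite cf_qX /=.
case: ifP => [/dvdnP[k ->]|h].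
  by rewrite mulnK // -{2}[d]mul1n eqn_pmul2r.
by case: eqP => // e; rewrite e dvdnn in h.
Qed.
Lemma dil2q : dil2 q = q ^+ 2. Proof. exact: dil_q. Qed.
Lemma dil5q : dil5 q = q ^+ 5. Proof. exact: dil_q. Qed.

Lemma dil25 f : dil2 (dil5 f) = dil5 (dil2 f).
Proof.
apply: fpsP => n /=; repeat (case: ifP); try lia; move=> *; rewrite ?if_same //.
by rewrite -!divnMA mulnC.
Qed.

Lemma vanish_dil d N f : (0 < d)%N -> vanish N f -> vanish N (dil d f).
Proof.
move=> d0 vf i iN /=; case: ifP => // _; apply: vf.
exact: leq_ltn_trans (leq_div _ _) iN.
Qed.

Lemma fsum_dil d F : (0 < d)%N -> summable F -> fsum (fun k => dil d (F k)) = dil d (fsum F).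
Proof.
move=> d0 sF; apply: fpsP => n; rewrite /= -/(fsum F).
case: ifP => h; last by rewrite big1.
have := cf_fsum sF (leq_ltn_trans (leq_div n d) (ltnSn n)).
by rewrite /= => ->.
Qed.

Lemma fsum_dil2 F : summable F -> fsum (fun k => dil2 (F k)) = dil2 (fsum F).
Proof. exact: fsum_dil. Qed.
Lemma fsum_dil5 F : summable F -> fsum (fun k => dil5 (F k)) = dil5 (fsum F).
Proof. exact: fsum_dil. Qed.

(** The operator U_r; [diss] below reassembles a series from its five components. *)
Definition sect r f := Fps (fun n => cf f (5 * n + r)).

Lemma cf_sect r f n : cf (sect r f) n = cf f (5 * n + r). Proof. by []. Qed.

Lemma sectD r f g : sect r (f + g) = sect r f + sect r g.
Proof. exact: fpsP. Qed.
Lemma sectB r f g : sect r (f - g) = sect r f - sect r g.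
Proof. exact: fpsP. Qed.
Lemma sectMn r f k : sect r (f *+ k) = sect r f *+ k.
Proof. by apply: fpsP => n; rewrite cfMn !cf_sect cfMn. Qed.

Definition diss c0 c1 c2 c3 c4 : fps :=
  dil5 c0 + q * dil5 c1 + q ^+ 2 * dil5 c2 + q ^+ 3 * dil5 c3 + q ^+ 4 * dil5 c4.

Lemma sect_qdil r s f : (r < 5)%N -> (s < 5)%N ->
  sect r (q ^+ s * dil5 f) = if r == s then f else 0.
Proof.
move=> r5 s5; apply: fpsP => n; rewrite cf_sect cf_qXM cf_dil5.
case: eqP => [->|ne].
  by rewrite leq_addl addnK dvdn_mulr // mulKn.
by case: leqP => // le; case: ifP => //; lia.
Qed.

Lemma sect_diss r c0 c1 c2 c3 c4 : (r < 5)%N ->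
  sect r (diss c0 c1 c2 c3 c4) = nth 0 [:: c0; c1; c2; c3; c4] r.
Proof.
move=> r5; rewrite /diss -[dil5 c0]mul1r -(expr0 q) -{2}(expr1 q).
rewrite !sectD !sect_qdil //.
by case: r r5 => [|[|[|[|[|r]]]]] //= _; rewrite ?addr0 ?add0r.
Qed.

Lemma diss_sect f : f = diss (sect 0 f) (sect 1 f) (sect 2 f) (sect 3 f) (sect 4 f).
Proof.
have eqs (g h : fps) : (forall r, (r < 5)%N -> sect r g = sect r h) -> g = h.
  move=> e; apply: fpsP => n; have := e _ (ltn_pmod n (isT : 0 < 5)%N).
  by move/(congr1 (cf^~ (n %/ 5)%N)); rewrite !cf_sect mulnC -divn_eq.
by apply: eqs => r r5; rewrite sect_diss //; case: r r5 => [|[|[|[|[|r]]]]].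
Qed.

Lemma sectM r g f : (r < 5)%N -> sect r (dil5 g * f) = g * sect r f.
Proof.
move=> r5; rewrite {1}[f]diss_sect.
rewrite (_ : _ * _ = diss (g * sect 0 f) (g * sect 1 f) (g * sect 2 f) (g * sect 3 f) (g * sect 4 f)).
  by rewrite sect_diss //; case: r r5 => [|[|[|[|[|r]]]]].
by rewrite /diss !rmorphM /=; ring.
Qed.

Lemma sum5 (F : nat -> int) N : \sum_(i < 5 * N) F i =
  \sum_(k < N) (F (5 * k)%N + F (5 * k + 1)%N + F (5 * k + 2)%N + F (5 * k + 3)%N + F (5 * k + 4)%N).
Proof.
elim: N => [|N IH]; first by rewrite muln0 !big_ord0.
rewrite [RHS]big_ord_recr /= -IH (_ : 5 * N.+1 = (5 * N).+4.+1)%N; last by lia.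
by rewrite !big_ord_recr /= !addn1 addn2 addn3 addn4 -!addrA.
Qed.

Lemma fsum_split5 F : summable F -> fsum F =
  fsum (fun k => F (5 * k)%N) + fsum (fun k => F (5 * k + 1)%N) + fsum (fun k => F (5 * k + 2)%N)
  + fsum (fun k => F (5 * k + 3)%N) + fsum (fun k => F (5 * k + 4)%N).
Proof.
move=> sF; rewrite -!fsumD; apply: fpsP => n.
rewrite (@cf_fsum _ (5 * n.+1)) //; last by lia.
by rewrite (@sum5 (fun i => cf (F i) n)).
Qed.

End Dilation.

(** * Theta series and their product expansions *)

Section Shanks.
Local Open Scope ring_scope.
Variables (R : comNzRingType) (X y w z : nat -> R) (rho : R).
Hypothesis X0 : X 0%N = 0.
Hypothesis zS : forall n, z n.+1 = z n * rho.
Hypothesis step : forall n s, rho ^+ s * X n.+1 - w n = y s * z n - X s.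

(** Shanks's finite sums. When z n has order at least n only the term s = 0 survives in the limit,
    which is the product of the X i. The recurrence below also evaluates the sum as a partial theta
    series times a finite product; the two together give product expansions. *)
Definition shanks_sum n :=
  \sum_(s < n.+1) (\prod_(i < s) y i) * (\prod_(s <= i < n) X i.+1) * z n ^+ s.

(* The difference telescopes, its s-th term being v (s+1) - v s for
   v s = (y_0 ... y_(s-1)) (X_s ... X_n) z_n^s. *)
Lemma shanks_sumS n : shanks_sum n.+1 = w n * shanks_sum n
  + (\prod_(i < n.+1) y i) * (z n ^+ n.+1 + z n.+1 ^+ n.+1).
Proof.
have tele m : (m <= n)%N -> \sum_(s < m.+1) (\prod_(i < s) y i)
    * (\prod_(s <= i < n) X i.+1) * z n ^+ s * (y s * z n - X s) =
    (\prod_(i < m.+1) y i) * (\prod_(m <= i < n) X i.+1) * z n ^+ m.+1.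
  elim: m => [|m IH] mn.
    by rewrite big_ord1 big_ord1 big_ord0 X0 expr0 expr1; ring.
  rewrite big_ord_recr /= IH ?(ltnW mn) // (big_ltn mn) [\prod_(i < m.+2) _]big_ord_recr /=.
  by rewrite !exprS; ring.
rewrite /shanks_sum big_ord_recr /= big_geq // mulr1.
have -> : \sum_(s < n.+1) (\prod_(i < s) y i) * (\prod_(s <= i < n.+1) X i.+1) * z n.+1 ^+ s
  = \sum_(s < n.+1) (w n * ((\prod_(i < s) y i) * (\prod_(s <= i < n) X i.+1) * z n ^+ s)
    + (\prod_(i < s) y i) * (\prod_(s <= i < n) X i.+1) * z n ^+ s * (y s * z n - X s)).
  apply: eq_bigr => s _; rewrite -step big_nat_recr /= -1?ltnS // zS exprMn; ring.
rewrite big_split /= -mulr_sumr tele // big_geq // mulr1; ring.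
Qed.
End Shanks.

Section Theta.
Local Open Scope ring_scope.

Lemma shanks_sum_prod (X y z : nat -> fps) n : (exists c, z n = q ^+ n * c) ->
  vanish n (shanks_sum X y z n - \prod_(i < n) X i.+1).
Proof.
case=> c zn; rewrite /shanks_sum big_ord_recl big_ord0 mul1r expr0 mulr1 big_mkord addrC addKr.
apply: vanish_sum => i _; apply: vanishMl; rewrite zn exprS; do 2 apply: vanishMr.
exact: vanishq.
Qed.

Definition tri n := 'C(n.+1, 2).

Arguments tri : simpl never.

Lemma triS n : tri n.+1 = (tri n + n.+1)%N.
Proof. by rewrite /tri binS bin1. Qed.

Lemma triE n : (2 * tri n = n * n.+1)%N.
Proof. by elim: n => // n IH; rewrite triS mulnDr IH; lia. Qed.

Definition qfact n : fps := \prod_(i < n) (1 - q ^+ i.+1).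

(** With t = s here and t = s + 1 in [pentm], the exponents are t (3 t + 1) / 2 and t (3 t - 1) / 2,
    so that [euler] is the pentagonal number series. *)
Definition pentp : fps := fsum (fun s => (-1) ^+ s * q ^+ (s * s + tri s)).
Definition pentm : fps := fsum (fun s => (-1) ^+ s * q ^+ (s.+1 * s.+1 + tri s)).
Definition euler : fps := pentp - pentm.

Lemma vanish_sign k n N : (N <= n)%N -> vanish N ((-1) ^+ k * q ^+ n).
Proof. by move=> h; apply: vanish_signM; apply: (vanishW h); apply: vanishq. Qed.

Lemma pentp_summable : summable (fun s => (-1) ^+ s * q ^+ (s * s + tri s)).
Proof. by move=> s; apply: vanish_sign; have := triE s; nia. Qed.
Lemma pentm_summable : summable (fun s => (-1) ^+ s * q ^+ (s.+1 * s.+1 + tri s)).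
Proof. by move=> s; apply: vanish_sign; nia. Qed.

(** Euler's pentagonal number theorem: the Shanks sum is exactly a partial sum of the series, and it
    tends to the product. *)
Lemma euler_qfact n : vanish n (euler - qfact n).
Proof.
pose F := shanks_sum (fun i => 1 - q ^+ i) (fun i => - q ^+ i.+1) (fun n => q ^+ n).
have prody s : \prod_(i < s) (- q ^+ i.+1) = (-1) ^+ s * q ^+ tri s :> fps.
  elim: s => [|s IH]; first by rewrite big_ord0 mulr1.
  by rewrite big_ord_recr /= IH triS exprD !exprS; ring.
have FE m : F m = \sum_(s < m.+1) (-1) ^+ s * q ^+ (s * s + tri s)
                - \sum_(s < m) (-1) ^+ s * q ^+ (s.+1 * s.+1 + tri s).
  elim: m => [|m IH].
    by rewrite /F /shanks_sum !big_ord1 !big_ord0 big_geq // subr0 !mul1r.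
  rewrite /F (@shanks_sumS _ _ _ (fun=> 1) _ q) /= => [||k|k s]; last 1 first.
  - by rewrite !exprS; ring.
  - rewrite -/(F m) IH prody [in RHS]big_ord_recr [X in _ = _ - X]big_ord_recr /= mul1r.
    by rewrite -!exprM triS !mulSn !exprD !exprS; ring.
  - by rewrite subrr.
  - by rewrite exprSr.
have v1 : vanish n (F n - qfact n).
  by apply: shanks_sum_prod; exists 1; rewrite mulr1.
have v2 := vanishB (vanishW (leqnSn n) (fsum_vanish (N := n.+1) pentp_summable)) (fsum_vanish (N := n) pentm_summable).
have := vanishD v1 v2; rewrite FE; congr vanish; rewrite /euler /pentp /pentm; ring.
Qed.

Lemma vanish_mul_congr N f f' g g' : vanish N (f - f') -> vanish N (g - g') ->
  vanish N (f * g - f' * g').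
Proof.
move=> vf vg; rewrite (_ : _ - _ = (f - f') * g + f' * (g - g')); last by ring.
by apply: vanishD; [apply: vanishMr | apply: vanishMl].
Qed.

Lemma dil2_qfact n : dil2 (qfact n) = \prod_(i < n) (1 - q ^+ (2 * i.+1)).
Proof.
rewrite rmorph_prod; apply: eq_bigr => i _.
by rewrite rmorphB rmorph1 rmorphXn /= dil2q -exprM.
Qed.

Lemma euler2_qfact n : vanish n (dil2 euler - dil2 (qfact n)).
Proof. by rewrite -rmorphB; apply: vanish_dil => //; apply: euler_qfact. Qed.

Definition theta : fps := fsum (fun s => (-1) ^+ s * q ^+ (s * s)).
(** This is phi(-q), the sum of (-1)^s q^(s^2) over all integers s. *)
Definition phi : fps := theta *+ 2 - 1.

Lemma theta_summable : summable (fun s => (-1) ^+ s * q ^+ (s * s)).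
Proof. by move=> s; apply: vanish_sign; nia. Qed.

(** Gauss's product for phi(-q). The Shanks sum is the partial series times (-q; q)_m, and it tends
    to (q; q)_oo. *)
Lemma phi_euler : phi * dil2 euler = euler ^+ 2.
Proof.
pose F := shanks_sum (fun i => 1 - q ^+ i) (fun i => - (1 + q ^+ i)) (fun n => q ^+ n.+1).
pose qm n : fps := \prod_(i < n) (1 + q ^+ i.+1).
have qmS n : qm n.+1 = qm n * (1 + q ^+ n.+1) by rewrite /qm big_ord_recr.
(* The factor i = 0 is -2, which accounts for the double weight of the terms with s > 0. *)
have prody s : \prod_(i < s.+1) - (1 + q ^+ i) = (-1) ^+ s.+1 * qm s *+ 2.
  elim: s => [|s IH]; first by rewrite big_ord1 /qm big_ord0 expr0 expr1; ring.
  by rewrite big_ord_recr /= IH qmS !exprS; ring.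
have FE m : F m = ((\sum_(s < m.+1) (-1) ^+ s * q ^+ (s * s)) *+ 2 - 1) * qm m.
  elim: m => [|m IH].
    rewrite /F /shanks_sum /qm !big_ord1 !big_ord0 big_geq //=; ring.
  rewrite /F (@shanks_sumS _ _ _ (fun n => 1 + q ^+ n.+1) _ q) /= => [||k|k s]; last 1 first.
  - by rewrite !exprS; ring.
  - rewrite -/(F m) IH prody [in RHS]big_ord_recr qmS /=.
    by rewrite -!exprM (mulSn m.+1) exprD; ring.
  - by rewrite subrr.
  - by rewrite exprSr.
have qmE n : qm n * qfact n = dil2 (qfact n).
  rewrite dil2_qfact /qm /qfact -big_split; apply: eq_bigr => i _ /=.
  by rewrite mulnC exprM; ring.
apply: vanish_eq => N.
have v1 : vanish N (F N - qfact N).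
  by apply: shanks_sum_prod; exists q; rewrite exprSr.
have v2 := fsum_vanish (N := N.+1) theta_summable.
have {}v2 := vanishW (leqnSn N) v2.
have v3 := vanish_mul_congr (euler_qfact (n := N)) (euler_qfact (n := N)).
have v4 := vanishMl phi (euler2_qfact (n := N)).
have v5 := vanishMr (dil2 (qfact N) *+ 2) v2.
have := vanishB (vanishD v4 (vanishD v5 (vanishMr (qfact N) v1))) v3.
by rewrite FE -qmE /phi /theta; congr vanish; ring.
Qed.

Definition psi : fps := fsum (fun s => q ^+ tri s).

Lemma psi_summable : summable (fun s => q ^+ tri s).
Proof. by move=> s; apply: (@vanishW (tri s)); [have := triE s; nia | apply: vanishq]. Qed.

Definition qodd n : fps := \prod_(i < n) (1 - q ^+ (2 * i).+1).

Lemma qoddS n : qodd n.+1 = qodd n * (1 - q ^+ (2 * n).+1).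
Proof. exact: big_ord_recr. Qed.

Lemma qfact_even n : qfact (2 * n) = qodd n * dil2 (qfact n).
Proof.
rewrite dil2_qfact /qfact /qodd; elim: n => [|n IH]; first by rewrite muln0 !big_ord0 mulr1.
rewrite (_ : 2 * n.+1 = (2 * n).+2)%N; last by lia.
rewrite !big_ord_recr /= IH (_ : 2 * n.+1 = (2 * n).+2)%N; last by lia.
by ring.
Qed.

(** Gauss's product for the triangular series. Each step of the Shanks recurrence adds two
    triangular exponents, so the m-th sum contains the terms up to index 2 m. *)
Lemma psi_euler : psi * euler = dil2 euler ^+ 2.
Proof.
pose F := shanks_sum (fun i => 1 - q ^+ (2 * i)) (fun i => 1 - q ^+ (2 * i).+1)
  (fun n => q ^+ (2 * n).+1).
have FE m : F m = (\sum_(s < (2 * m).+1) q ^+ tri s) * qodd m.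
  elim: m => [|m IH].
    by rewrite /F /shanks_sum /qodd !big_ord1 !big_ord0 big_geq //= expr0; ring.
  rewrite /F (@shanks_sumS _ _ _ (fun n => 1 - q ^+ (2 * n).+1) _ (q ^+ 2)) /= => [||k|k s]; last 1 first.
  - by rewrite -exprM !mulnS !exprS; ring.
  - rewrite -/(F m) IH -/(qodd m.+1) qoddS.
    have -> : (2 * m.+1 = (2 * m).+2)%N by lia.
    rewrite [X in _ = X * _]big_ord_recr /= [X in _ = (X + _) * _]big_ord_recr /= -!exprM.
    have -> : ((2 * m).+1 * m.+1 = tri (2 * m).+1)%N by have := triE (2 * m).+1; lia.
    have -> : ((2 * m).+3 * m.+1 = tri (2 * m).+2)%N by have := triE (2 * m).+2; lia.
    by ring.
  - by rewrite muln0 subrr.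
  - by rewrite mulnS -exprD; congr (_ ^+ _); lia.
apply: vanish_eq => N.
have v1 : vanish N (F N - dil2 (qfact N)).
  rewrite dil2_qfact; apply: (@shanks_sum_prod (fun i => 1 - q ^+ (2 * i))).
  by exists (q ^+ N.+1); rewrite -exprD; congr (_ ^+ _); lia.
have v2 := fsum_vanish (N := (2 * N).+1) psi_summable.
have {}v2 : vanish N _ := vanishW (ltnW (leq_pmull N (isT : 0 < 2)%N : N < (2 * N).+1)%N) v2.
have v3 := vanish_mul_congr (euler2_qfact (n := N)) (euler2_qfact (n := N)).
have v4 : vanish N (euler - qfact (2 * N)) := vanishW (leq_pmull N (isT : 0 < 2)%N) (euler_qfact (n := 2 * N)).
have := vanishB (vanishD (vanishMl psi v4) (vanishD (vanishMr (qfact (2 * N)) v2)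
   (vanishMr (dil2 (qfact N)) v1))) v3.
by rewrite FE qfact_even /psi; congr vanish; ring.
Qed.

Definition sign_series (c : nat -> nat) (e : nat -> nat) : fps := fsum (fun k => (-1) ^+ c k * q ^+ e k).

(** Used on the terms whose index lies in one residue class modulo 5, where all exponents share the
    residue d. *)
Lemma fsum_class (c e e' : nat -> nat) d : (forall k, e k = 5 * e' k + d)%N ->
  (forall k, k <= e' k)%N ->
  fsum (fun k => (-1) ^+ c k * q ^+ e k) = q ^+ d * dil5 (sign_series c e').
Proof.
move=> h h'.
have s' : summable (fun k => (-1) ^+ c k * q ^+ e' k) by move=> k; apply: vanish_sign.
rewrite /sign_series -fsum_dil5 // -fsumMl; last first.
  by move=> k; apply: vanish_dil => //; apply: s'.
apply: eq_fsum => k; rewrite h rmorphM rmorph_sign rmorphXn /= dil5q.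
by rewrite exprD exprM; ring.
Qed.

Lemma sign5 k : (-1) ^+ (5 * k) = (-1) ^+ k :> fps.
Proof. by rewrite -signr_odd oddM /= signr_odd. Qed.

(** Squares are 0, 1 or 4 modulo 5, and the indices divisible by 5 reproduce the series at q^25. *)
Lemma phi_diss : exists U V, phi = diss (dil5 phi) U 0 0 V.
Proof.
rewrite /phi; set t := theta.
have tE : t = dil5 (dil5 theta) + q ^+ 1 * dil5 (sign_series (fun k => 5 * k + 1)%N (fun k => 5 * k * k + 2 * k)%N)
  + q ^+ 4 * dil5 (sign_series (fun k => 5 * k + 2)%N (fun k => 5 * k * k + 4 * k)%N)
  + q ^+ 4 * dil5 (sign_series (fun k => 5 * k + 3)%N (fun k => 5 * k * k + 6 * k + 1)%N)
  + q ^+ 1 * dil5 (sign_series (fun k => 5 * k + 4)%N (fun k => 5 * k * k + 8 * k + 3)%N).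
  rewrite [t](fsum_split5 theta_summable); congr (_ + _ + _ + _ + _).
  - rewrite (@fsum_class _ _ (fun k => 5 * (k * k))%N 0); [|lia|nia].
    rewrite mul1r {1}/sign_series (@fsum_class _ _ (fun k => k * k)%N 0) ?mul1r; [|lia|nia].
    by congr (dil5 (dil5 _)); apply: eq_fsum => k; rewrite sign5.
  - by apply: fsum_class; [lia|nia].
  - by apply: fsum_class; [lia|nia].
  - by apply: fsum_class; [lia|nia].
  - by apply: fsum_class; [lia|nia].
set A := sign_series _ _ in tE; set B := sign_series _ _ in tE; set C := sign_series _ _ in tE; set D := sign_series _ _ in tE.
exists ((A + D) *+ 2), ((B + C) *+ 2).
rewrite /diss {1}tE /t !expr1 !rmorph0 !rmorphMn !rmorphB !rmorphMn !rmorphD /= !rmorph1; ring.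
Qed.
End Theta.

(** * The 5-dissection of Euler's product *)

Section Dissections.
Local Open Scope ring_scope.

(** Pentagonal numbers are 0, 1 or 2 modulo 5. In residue 1, the indices 5 k + 4 of [pentp]
    reproduce [pentm] at q^25 and the indices 5 k of [pentm] reproduce [pentp]; this exchange
    produces the minus sign. *)
Lemma euler_diss : exists J0 J2, euler = diss J0 (- dil5 euler) J2 0 0.
Proof.
have pE : pentp =
    q ^+ 0 * dil5 (sign_series (muln 5) (fun k => 5 * (k * k + tri k) - 2 * k)%N)
  + q ^+ 2 * dil5 (sign_series (fun k => 5 * k + 1)%N (fun k => 5 * (k * k + tri k) + k)%N)
  + q ^+ 2 * dil5 (sign_series (fun k => 5 * k + 2)%N (fun k => 5 * (k * k + tri k) + 4 * k + 1)%N)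
  + q ^+ 0 * dil5 (sign_series (fun k => 5 * k + 3)%N (fun k => 5 * (k * k + tri k) + 7 * k + 3)%N)
  + q ^+ 1 * dil5 (dil5 pentm).
  rewrite /pentp (fsum_split5 pentp_summable); congr (_ + _ + _ + _ + _).
  1,2,3,4: by apply: fsum_class => k; have := triE k;
    [have := triE (5 * k); have := triE (5 * k + 1); have := triE (5 * k + 2);
     have := triE (5 * k + 3); nia | nia].
  rewrite (@fsum_class _ _ (fun k => 5 * (k.+1 * k.+1 + tri k))%N 1) => [|k|k]; last 2 first.
  - by have := triE k; have := triE (5 * k + 4); nia.
  - by have := triE k; nia.
  rewrite {1}/sign_series (@fsum_class _ _ (fun k => k.+1 * k.+1 + tri k)%N 0) ?mul1r => [|k|k]; [|lia|nia].
  by congr (_ * dil5 (dil5 _)); apply: eq_fsum => k; rewrite exprD sign5; ring.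
have mE : pentm =
    q ^+ 1 * dil5 (dil5 pentp)
  + q ^+ 0 * dil5 (sign_series (fun k => 5 * k + 1)%N (fun k => 5 * (k * k + tri k) + 3 * k + 1)%N)
  + q ^+ 2 * dil5 (sign_series (fun k => 5 * k + 2)%N (fun k => 5 * (k * k + tri k) + 6 * k + 2)%N)
  + q ^+ 2 * dil5 (sign_series (fun k => 5 * k + 3)%N (fun k => 5 * (k * k + tri k) + 9 * k + 4)%N)
  + q ^+ 0 * dil5 (sign_series (fun k => 5 * k + 4)%N (fun k => 5 * (k * k + tri k) + 12 * k + 7)%N).
  rewrite /pentm (fsum_split5 pentm_summable); congr (_ + _ + _ + _ + _).
  2,3,4,5: by apply: fsum_class => k; have := triE k;
    [have := triE (5 * k + 1); have := triE (5 * k + 2);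
     have := triE (5 * k + 3); have := triE (5 * k + 4); nia | nia].
  rewrite (@fsum_class _ _ (fun k => 5 * (k * k + tri k))%N 1) => [|k|k]; last 2 first.
  - by have := triE k; have := triE (5 * k); nia.
  - by have := triE k; nia.
  rewrite {1}/sign_series (@fsum_class _ _ (fun k => k * k + tri k)%N 0) ?mul1r => [|k|k]; [|lia|]; last first.
    by have := triE k; nia.
  by congr (_ * dil5 (dil5 _)); apply: eq_fsum => k; rewrite sign5.
rewrite /euler; set p := pentp in pE *; set m := pentm in mE *.
move: pE mE; set p0 := sign_series _ _; set p1 := sign_series _ _; set p2 := sign_series _ _; set p3 := sign_series _ _.
move=> pE; set m0 := sign_series _ _; set m1 := sign_series _ _; set m2 := sign_series _ _; set m3 := sign_series _ _ => mE.
exists (p0 + p3 - m0 - m3), (p1 + p2 - m1 - m2).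
rewrite {1}pE {1}mE /diss !rmorph0 !(rmorphB, rmorphD, rmorphN) /= -/p -/m; ring.
Qed.
End Dissections.

(** * Sums of two squares *)

Section SumsOfTwoSquares.
Local Open Scope ring_scope.

Definition zrange B : seq int := [seq s%:Z | s <- iota 0 B.+1] ++ [seq - s%:Z | s <- iota 1 B].

Lemma mem_zrange B (x : int) : (x \in zrange B) = (`|x| <= B)%N.
Proof.
rewrite mem_cat; apply/orP/idP => [[]/mapP[s]|h]; rewrite ?mem_iota.
- by move=> ? ->; lia.
- by move=> ? ->; lia.
case: (lerP 0 x) => x0.
  by left; apply/mapP; exists `|x|%N; rewrite ?mem_iota; lia.
by right; apply/mapP; exists `|x|%N; rewrite ?mem_iota; lia.
Qed.

Lemma uniq_zrange B : uniq (zrange B).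
Proof.
rewrite cat_uniq !map_inj_uniq ?iota_uniq; [|by move=> ? ?; lia|by move=> ? ?; lia].
rewrite andTb andbT; apply/hasPn => x /mapP[s]; rewrite mem_iota => hs ->.
by apply/negP => /mapP[t]; rewrite mem_iota => ht e; lia.
Qed.

Definition reps n : seq (int * int) :=
  [seq p <- allpairs pair (zrange n) (zrange n) | p.1 ^+ 2 + p.2 ^+ 2 == n%:Z].

Lemma absz_le_sqr (x y : int) n : x ^+ 2 + y ^+ 2 = n%:Z -> (`|x| <= n)%N.
Proof.
move=> e; have hx : (`|x| * `|x|)%N%:Z = x ^+ 2 by rewrite PoszM; nia.
have hy : (`|y| * `|y|)%N%:Z = y ^+ 2 by rewrite PoszM; nia.
by move: e; rewrite -hx -hy => e; nia.
Qed.

Lemma mem_reps n p : (p \in reps n) = (p.1 ^+ 2 + p.2 ^+ 2 == n%:Z).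
Proof.
rewrite mem_filter; case: eqP => // e; rewrite andTb.
apply/allpairsP; exists p; rewrite !mem_zrange; split; last by case: p {e}.
  exact: absz_le_sqr e.
by apply: absz_le_sqr (p.1) _ _; rewrite addrC.
Qed.

Lemma uniq_reps n : uniq (reps n).
Proof.
apply: filter_uniq; apply: allpairs_uniq; rewrite ?uniq_zrange //.
by move=> [? ?] [? ?].
Qed.

Definition sgp (p : int * int) : int := (-1) ^+ (`|p.1| + `|p.2|)%N.

Lemma sgp_odd p p' : odd (`|p.1| + `|p.2|) = odd (`|p'.1| + `|p'.2|) -> sgp p = sgp p'.
Proof. by move=> e; rewrite /sgp -signr_odd e signr_odd. Qed.

Lemma cf_signq s k n : cf ((-1) ^+ s * q ^+ k) n = if k == n then (-1) ^+ s else 0.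
Proof.
rewrite -signr_odd -[in RHS]signr_odd eq_sym.
by case: (odd s); rewrite ?expr1 ?expr0 ?mulN1r ?mul1r ?cfN cf_qX; case: eqP => //; rewrite oppr0.
Qed.

Lemma cf_phi n B : (n <= B)%N ->
  cf phi n = \sum_(x <- zrange B) (if x ^+ 2 == n%:Z then (-1) ^+ `|x|%N else 0).
Proof.
move=> nB; rewrite /phi cfB cfMn (cf_fsum theta_summable (N := B.+1)) // cf1.
rewrite big_cat !big_map; pose H s : int := if (s * s == n)%N then (-1) ^+ s else 0.
have -> : \sum_(j <- iota 1 B) (if (- j%:Z) ^+ 2 == n%:Z then (-1) ^+ `|- j%:Z|%N else 0)
   = \sum_(1 <= s < B.+1) H s.
  by rewrite /index_iota subn1 /=; apply: eq_bigr => s _; rewrite /H abszN sqrrN expr2 -PoszM eqz_nat.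
have -> : \sum_(j <- iota 0 B.+1) (if j%:Z ^+ 2 == n%:Z then (-1) ^+ `|j|%N else 0)
   = \sum_(0 <= s < B.+1) H s.
  by rewrite /index_iota subn0; apply: eq_bigr => s _; rewrite /H expr2 -PoszM eqz_nat.
under eq_bigr do rewrite cf_signq.
rewrite -(big_mkord predT H) (big_ltn (ltn0Sn B)) {1 3}/H expr0 eq_sym.
by case: eqP => _ /=; ring.
Qed.

Lemma cf_phi2 n : cf (phi ^+ 2) n = \sum_(p <- reps n) sgp p.
Proof.
rewrite expr2 cfM big_filter [RHS]big_mkcond [RHS]big_allpairs_dep.
have e (i : 'I_n.+1) : cf phi i * cf phi (n - i) = \sum_(x <- zrange n) \sum_(y <- zrange n)
    (if x ^+ 2 == i%:Z then (-1) ^+ `|x|%N else 0) *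
    (if y ^+ 2 == (n - i)%N%:Z then (-1) ^+ `|y|%N else 0).
  rewrite (cf_phi (B := n)) -1?ltnS // (cf_phi (B := n)) ?leq_subr // mulr_suml.
  by apply: eq_bigr => x _; rewrite mulr_sumr.
rewrite (eq_bigr _ (fun i _ => e i)) {e}.
rewrite exchange_big; apply: eq_bigr => x _ /=.
rewrite exchange_big; apply: eq_bigr => y _ /=.
case: eqP => e; last first.
  rewrite big1 // => i _; case: eqP => [ex|]; last by rewrite mul0r.
  case: eqP => [ey|]; last by rewrite mulr0.
  by case: e; rewrite ex ey -PoszD subnKC // -ltnS.
have xn : (`|x ^+ 2| < n.+1)%N by rewrite expr2 in e *; nia.
rewrite (bigD1 (Ordinal xn)) //= big1 => [|i ni].
  have -> : x ^+ 2 == `|x ^+ 2|%N by rewrite expr2; apply/eqP; nia.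
  have -> : y ^+ 2 == (n - `|x ^+ 2|)%N by rewrite !expr2 in e xn *; apply/eqP; nia.
  by rewrite addr0 /sgp exprD.
case: eqP => [ex|]; last by rewrite mul0r.
by case/eqP: ni; apply: val_inj; rewrite /= ex.
Qed.

(** A Gaussian integer x + i y of norm 5 n is divisible by 2 + i or by 2 - i, and by both exactly
    when 5 divides it; inclusion-exclusion then counts the representations of 5 n through those of n
    and n / 5. The sign only depends on the parity of the norm, which division by 5 preserves. *)
Lemma phi2_sect0 : sect 0 (phi ^+ 2) = phi ^+ 2 *+ 2 - dil5 phi ^+ 2.
Proof.
apply: fpsP => n; rewrite cf_sect addn0 cfB cfMn -rmorphXn cf_dil5 !cf_phi2.
pose A (p : int * int) := (5 %| p.1 - p.2 *+ 2)%Z.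
pose B (p : int * int) := (5 %| p.1 + p.2 *+ 2)%Z.
have permr (P : pred (int * int)) g m : injective g ->
    (forall p, (p \in reps (5 * n)) && P p = (p \in map g (reps m))) ->
    (forall p, sgp (g p) = sgp p) ->
    \sum_(p <- reps (5 * n) | P p) sgp p = \sum_(p <- reps m) sgp p.
  move=> ginj gP gs; rewrite -big_filter (perm_big (map g (reps m))).
    by rewrite big_map; apply: eq_bigr => p _; rewrite gs.
  apply: uniq_perm => [||p]; first exact: filter_uniq (uniq_reps _).
    by rewrite map_inj_uniq ?uniq_reps.
  by rewrite mem_filter -gP andbC.
have sA : \sum_(p <- reps (5 * n) | A p) sgp p = \sum_(p <- reps n) sgp p.
  (* Multiplication by 2 + i. *)
  apply: (permr _ (fun p => (p.1 *+ 2 - p.2, p.1 + p.2 *+ 2))).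
  - by move=> [x y] [x' y'] /= []; move=> *; congr pair; lia.
  - move=> [x y]; rewrite mem_reps /A /=; apply/andP/mapP => [[/eqP e /dvdzP[k hk]]|[[x' y']]].
      exists (y + k *+ 2, - k); last by congr pair => /=; lia.
      rewrite mem_reps /=; apply/eqP; have ex : x = y *+ 2 + k *+ 5 by lia.
      by move: e; rewrite ex !expr2; lia.
    rewrite mem_reps /= => /eqP e [-> ->]; split; first by apply/eqP; move: e; rewrite !expr2; lia.
    by apply/dvdzP; exists (- y'); lia.
  - by move=> [x y]; apply: sgp_odd => /=; lia.
have sB : \sum_(p <- reps (5 * n) | B p) sgp p = \sum_(p <- reps n) sgp p.
  (* Multiplication by 2 + i followed by conjugation; the image consists of the multiples of 2 -
     i. *)
  apply: (permr _ (fun p => (p.1 *+ 2 - p.2, - p.1 - p.2 *+ 2))).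
  - by move=> [x y] [x' y'] /= []; move=> *; congr pair; lia.
  - move=> [x y]; rewrite mem_reps /B /=; apply/andP/mapP => [[/eqP e /dvdzP[k hk]]|[[x' y']]].
      exists (- y + k *+ 2, - k); last by congr pair => /=; lia.
      rewrite mem_reps /=; apply/eqP; have ex : x = k *+ 5 - y *+ 2 by lia.
      by move: e; rewrite ex !expr2; lia.
    rewrite mem_reps /= => /eqP e [-> ->]; split; first by apply/eqP; move: e; rewrite !expr2; lia.
    by apply/dvdzP; exists (- y'); lia.
  - by move=> [x y]; apply: sgp_odd => /=; lia.
have sAB : \sum_(p <- reps (5 * n) | A p && B p) sgp p =
    if (5 %| n)%N then \sum_(p <- reps (n %/ 5)) sgp p else 0.
  have AB5 x y : A (x, y) && B (x, y) -> exists x' y', x = x' *+ 5 /\ y = y' *+ 5.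
    move=> /andP[/dvdzP[k hk] /dvdzP[l hl]].
    (* From 2 x = 5 (k + l) and 4 y = 5 (l - k), writing x = 6 x - 5 x and y = 16 y - 15 y. *)
    by exists (k *+ 3 + l *+ 3 - x), (l *+ 4 - k *+ 4 - y *+ 3); move: hk hl => /=; lia.
  case: ifP => [/dvdnP[m nm]|h5].
    rewrite nm mulnK // -nm.
    apply: (permr _ (fun p => (p.1 *+ 5, p.2 *+ 5))).
    - by move=> [x y] [x' y'] /= []; move=> *; congr pair; lia.
    - move=> [x y]; rewrite mem_reps; apply/andP/mapP => [[/eqP /= e /AB5[x' [y' [ex ey]]]]|[[x' y']]].
        exists (x', y'); last by rewrite ex ey.
        by rewrite mem_reps; apply/eqP; move: e; rewrite /= ex ey !expr2; lia.
      rewrite mem_reps => /eqP /= e [-> ->]; split.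
        by apply/eqP; move: e; rewrite /= !expr2; lia.
      by rewrite /A /B /=; apply/andP; split; lia.
    - by move=> [x y]; apply: sgp_odd => /=; lia.
  rewrite big_seq_cond big1 // => -[x y] /andP[]; rewrite mem_reps => /eqP /= e /AB5[x' [y' [ex ey]]].
  by move: e; rewrite ex ey !expr2; lia.
rewrite -sAB mulr2n -{1}sA -sB.
rewrite [in RHS](big_mkcond A) (big_mkcond B) (big_mkcond (fun p => _ && _)) /=.
rewrite -big_split -sumrB /= !big_seq; apply: eq_bigr => -[x y]; rewrite mem_reps => /eqP /= e.
(* Here x^2 - 4 y^2 = 5 (n - y^2), and 5 is prime. *)
have AB : A (x, y) || B (x, y).
  rewrite /A /B !dvdzE -Euclid_dvdM // -abszM -(dvdzE 5); apply/dvdzP.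
  by exists (n%:Z - y ^+ 2); move: e; rewrite /= !expr2; lia.
by move: AB; case: (A _); case: (B _) => //= _; ring.
Qed.
End SumsOfTwoSquares.

(** * The identity nu(q) + nu(-q) = 2 E_4^3 / E_2^2 *)

Section Nu.
Local Open Scope ring_scope.

Lemma cfM0 f g : cf (f * g) 0 = cf f 0 * cf g 0.
Proof. by rewrite cfM big_ord1. Qed.

Lemma cf_prod0 n (F : nat -> fps) : (forall i, cf (F i) 0 = 1) -> cf (\prod_(i < n) F i) 0 = 1.
Proof. by move=> F1; elim/big_ind: _ => // f g; rewrite cfM0 => -> ->. Qed.

Lemma cf_1q0 k : (0 < k)%N -> cf (1 - q ^+ k) 0 = 1.
Proof. by move=> k0; rewrite cfB cf_qX eq_sym (gtn_eqF k0) subr0. Qed.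

Definition q2fact n := dil2 (qfact n).

Lemma q2factS n : q2fact n.+1 = q2fact n * (1 - q ^+ (2 * n.+1)).
Proof. by rewrite /q2fact !dil2_qfact big_ord_recr. Qed.

Lemma q2fact_unit n : q2fact n \is a GRing.unit.
Proof.
apply: fps_unitE; rewrite /q2fact dil2_qfact.
by apply: (@cf_prod0 _ (fun i => 1 - q ^+ (2 * i.+1))) => i; apply: cf_1q0.
Qed.

Lemma q2fact_invS n : (1 - q ^+ (2 * n.+1)) * (q2fact n.+1)^-1 = (q2fact n)^-1.
Proof.
apply: (mulrI (q2fact_unit n)); rewrite mulrA -q2factS.
by rewrite !mulrV // q2fact_unit.
Qed.

Lemma vanish_qM n N f : (N <= n)%N -> vanish N (q ^+ n * f).
Proof. by move=> h; apply: vanishMr; apply: (vanishW h); apply: vanishq. Qed.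

(** By Euler's expansions [Sser k] is (-q^(2k+1); q^2)_oo and [Rser k] is the inverse of (q^(2k+1);
    q^2)_oo. This is obtained from their recurrences in k and their common limit 1. *)
Definition Sser k := fsum (fun m => q ^+ (m * m + 2 * k * m) * (q2fact m)^-1).
Definition Rser k := fsum (fun m => q ^+ (m * (2 * k).+1) * (q2fact m)^-1).

Lemma Sser_summable k : summable (fun m => q ^+ (m * m + 2 * k * m) * (q2fact m)^-1).
Proof. by move=> m; apply: vanish_qM; nia. Qed.
Lemma Rser_summable k : summable (fun m => q ^+ (m * (2 * k).+1) * (q2fact m)^-1).
Proof. by move=> m; apply: vanish_qM; nia. Qed.

(** The factor 1 - q^(2m) kills the term m = 0 and cancels the last factor of the denominator in the
    others. *)
Lemma fsum_q2fact_shift (e : nat -> nat) : (forall m, m <= e m)%N ->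
  fsum (fun m => q ^+ e m * (1 - q ^+ (2 * m)) * (q2fact m)^-1)
  = fsum (fun m => q ^+ e m.+1 * (q2fact m)^-1).
Proof.
move=> he; rewrite fsum_recl => [|m]; last by rewrite -mulrA; apply: vanish_qM.
rewrite muln0 subrr mulr0 mul0r add0r; apply: eq_fsum => m.
by rewrite -mulrA q2fact_invS.
Qed.

Lemma SserS k : Sser k = (1 + q ^+ (2 * k).+1) * Sser k.+1.
Proof.
suff : Sser k - Sser k.+1 = q ^+ (2 * k).+1 * Sser k.+1.
  by move/eqP; rewrite subr_eq => /eqP ->; ring.
rewrite /Sser -fsumN -fsumD.
rewrite (eq_fsum (G := fun m => q ^+ (m * m + 2 * k * m) * (1 - q ^+ (2 * m)) * (q2fact m)^-1)); last first.
  move=> m; have -> : (m * m + 2 * k.+1 * m = m * m + 2 * k * m + 2 * m)%N by lia.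
  by rewrite (exprD _ (m * m + 2 * k * m)); ring.
rewrite fsum_q2fact_shift; last by move=> m; nia.
rewrite -fsumMl; last exact: Sser_summable.
by apply: eq_fsum => m; rewrite mulrA -exprD; congr (q ^+ _ * _); lia.
Qed.

Lemma RserS k : (1 - q ^+ (2 * k).+1) * Rser k = Rser k.+1.
Proof.
rewrite mulrBl mul1r -fsumMl; last exact: Rser_summable.
have -> : fsum (fun m => q ^+ (2 * k).+1 * (q ^+ (m * (2 * k).+1) * (q2fact m)^-1))
    = fsum (fun m => q ^+ (m * (2 * k).+1) * (1 - q ^+ (2 * m)) * (q2fact m)^-1).
  rewrite fsum_q2fact_shift; last by move=> m; nia.
  by apply: eq_fsum => m; rewrite mulrA -exprD; congr (q ^+ _ * _); lia.
rewrite -fsumN -fsumD; apply: eq_fsum => m.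
have -> : (m * (2 * k.+1).+1 = m * (2 * k).+1 + 2 * m)%N by lia.
by rewrite exprD; ring.
Qed.

Definition qoddp n : fps := \prod_(i < n) (1 + q ^+ (2 * i).+1).

Lemma qoddpS n : qoddp n.+1 = qoddp n * (1 + q ^+ (2 * n).+1).
Proof. exact: big_ord_recr. Qed.

Lemma Sser_qoddp K : Sser 0 = qoddp K * Sser K.
Proof.
elim: K => [|K IH]; first by rewrite /qoddp big_ord0 mul1r.
by rewrite IH qoddpS SserS mulrA.
Qed.

Lemma Rser_qodd K : qodd K * Rser 0 = Rser K.
Proof.
elim: K => [|K IH]; first by rewrite /qodd big_ord0 mul1r.
by rewrite qoddS -RserS -IH; ring.
Qed.

Lemma q2fact0 : (q2fact 0)^-1 = 1.
Proof. by rewrite /q2fact dil2_qfact big_ord0 invr1. Qed.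

Lemma Sser_lim K : vanish K (Sser K - 1).
Proof.
rewrite /Sser fsum_recl; last exact: Sser_summable.
rewrite q2fact0 mulr1 !muln0 addn0 expr0 addrC addKr.
by apply: vanish_fsum => m; apply: vanish_qM; nia.
Qed.

Lemma Rser_lim K : vanish K (Rser K - 1).
Proof.
rewrite /Rser fsum_recl; last exact: Rser_summable.
rewrite q2fact0 mulr1 mul0n expr0 addrC addKr.
by apply: vanish_fsum => m; apply: vanish_qM; nia.
Qed.

Lemma Rser_euler : Rser 0 * euler = dil2 euler.
Proof.
apply: vanish_eq => N.
have v1 : vanish N (euler - qfact (2 * N)) := vanishW (leq_pmull N (isT : 0 < 2)%N) (euler_qfact (n := 2 * N)).
have v2 := euler2_qfact (n := N).
have := vanishB (vanishD (vanishMl (Rser 0) v1) (vanishMr (dil2 (qfact N)) (Rser_lim (K := N)))) v2.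
by rewrite -(Rser_qodd N) qfact_even; congr vanish; ring.
Qed.

Lemma qoddp_qodd N : qoddp N * qodd N = dil2 (qodd N).
Proof.
rewrite rmorph_prod -big_split; apply: eq_bigr => i _ /=.
by rewrite rmorphB rmorph1 rmorphXn /= dil2q exprAC; ring.
Qed.

(** That is, (-q; q^2)_oo = E_2^2 / (E_1 E_4), a consequence of [qoddp_qodd]. *)
Lemma Sser_euler : Sser 0 * euler * dil2 (dil2 euler) = dil2 euler ^+ 2.
Proof.
apply: vanish_eq => N.
have v1 : vanish N (euler - qfact (2 * N)) := vanishW (leq_pmull N (isT : 0 < 2)%N) (euler_qfact (n := 2 * N)).
have v2 : vanish N (dil2 euler - dil2 (qfact (2 * N))) :=
  vanishW (leq_pmull N (isT : 0 < 2)%N) (euler2_qfact (n := 2 * N)).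
have v3 := euler2_qfact (n := N).
have v4 : vanish N (dil2 (dil2 euler) - dil2 (dil2 (qfact N))).
  by rewrite -rmorphB; apply: vanish_dil.
have w1 := vanishMl (Sser 0) (vanish_mul_congr v1 v4).
have w2 := vanish_mul_congr v2 v3.
have w3 := vanishMr (dil2 (qfact (2 * N)) * dil2 (qfact N)) (Sser_lim (K := N)).
have := vanishB (vanishD w1 w3) w2.
rewrite (Sser_qoddp N) !qfact_even !rmorphM /= -!qoddp_qodd; congr vanish; ring.
Qed.

(** [shell] is nu(-q) and [Bser 0] is nu(q); the parameter of [Bser] serves the recurrence
    [BserS]. *)
Definition shell : fps := fsum (fun n => q ^+ n * qoddp n).
Definition Bser j : fps := fsum (fun n => (-1) ^+ n * q ^+ (n * (2 * j).+1) * qodd n).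

Lemma shell_summable : summable (fun n => q ^+ n * qoddp n).
Proof. by move=> n; apply: vanish_qM. Qed.
Lemma Bser_summable j : summable (fun n => (-1) ^+ n * q ^+ (n * (2 * j).+1) * qodd n).
Proof. by move=> n; apply: vanishMr; apply: vanish_sign; nia. Qed.

Lemma BserS j : (1 + q ^+ (2 * j).+1) * Bser j = 1 + q ^+ (2 * j).+2 * Bser j.+1.
Proof.
have s1 := @Bser_summable j.
suff : Bser j = 1 + (- q ^+ (2 * j).+1 * Bser j + q ^+ (2 * j).+2 * Bser j.+1).
  by move=> e; rewrite mulrDl mul1r {1}e; ring.
rewrite {1}/Bser (fsum_recl s1) mul0n mul1r expr0 mul1r /qodd big_ord0 -/qodd; congr (1 + _).
rewrite -!fsumMl //; last exact: Bser_summable.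
rewrite -fsumD; apply: eq_fsum => n; rewrite -/(qodd n) -/(qodd n.+1) qoddS.
have -> : (n * (2 * j.+1).+1 = n * (2 * j).+1 + 2 * n)%N by lia.
by rewrite mulSn (exprD _ (2 * j).+1) (exprD _ (n * (2 * j).+1) (2 * n)) !exprS; ring.
Qed.

(** Iterating [BserS] gives the Eulerian form of nu(q), the sum of q^(k^2+k) / (-q; q^2)_(k+1). The
    factor [Sser 0] clears the denominators and the iteration becomes a telescoping sum. *)
Lemma Sser_Bser : Sser 0 * Bser 0 = fsum (fun k => q ^+ (k * k + k) * Sser k.+1).
Proof.
rewrite (@fsum_telescope _ (fun k => q ^+ (k * k + k) * (Sser k * Bser k))) => [|k|k].
- by rewrite mul1r.
- by apply: vanish_qM; nia.
have -> : (k.+1 * k.+1 + k.+1 = k * k + k + (2 * k).+2)%N by lia.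
rewrite (exprD _ (k * k + k)) (SserS k).
have -> : (1 + q ^+ (2 * k).+1) * Sser k.+1 * Bser k = Sser k.+1 * (1 + q ^+ (2 * k).+2 * Bser k.+1).
  by rewrite -BserS; ring.
by ring.
Qed.

(** This is (n - m)^2 + n: at least one of the two truncated differences is zero. *)
Definition dsq n m := ((n - m) * (n - m) + (m - n) * (m - n) + n)%N.

(** Passing to n + 1 multiplies by q + q^(2n+2). After a shift of m the part from q carries the
    factor 1 - q^(2m), and the other part restores the missing term, since dsq(n+1, m) + 2 m = 2 n +
    2 + dsq(n, m). *)
Lemma shell_Sser n : q ^+ n * qoddp n * Sser 0 = fsum (fun m => q ^+ dsq n m * (q2fact m)^-1).
Proof.
elim: n => [|n IH].
  rewrite /qoddp big_ord0 !mul1r; apply: eq_fsum => m.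
  by congr (q ^+ _ * _); rewrite /dsq; lia.
have -> : q ^+ n.+1 * qoddp n.+1 * Sser 0 = (q + q ^+ (2 * n).+2) * (q ^+ n * qoddp n * Sser 0).
  by rewrite qoddpS !exprS; ring.
rewrite IH mulrDl -!fsumMl; try by move=> m; apply: vanish_qM; rewrite /dsq; nia.
have -> : fsum (fun m => q * (q ^+ dsq n m * (q2fact m)^-1))
   = fsum (fun m => q ^+ dsq n.+1 m * (1 - q ^+ (2 * m)) * (q2fact m)^-1).
  rewrite fsum_q2fact_shift; last by move=> m; rewrite /dsq; nia.
  by apply: eq_fsum => m; rewrite mulrA -exprS; congr (q ^+ _ * _); rewrite /dsq !subSS; lia.
rewrite -fsumD; apply: eq_fsum => m.
have e : (dsq n.+1 m + 2 * m = (2 * n).+2 + dsq n m)%N.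
  by rewrite /dsq; case: (leqP m n) => h; [rewrite subSn //|]; nia.
by rewrite [q ^+ (2 * n).+2 * _]mulrA -exprD -e (exprD _ (dsq n.+1 m)); ring.
Qed.

Lemma dsq_summable m : summable (fun n => q ^+ dsq n m).
Proof. by move=> n; rewrite -[q ^+ _]mulr1; apply: vanish_qM; rewrite /dsq; nia. Qed.

Lemma lam_sq_summable m : summable (fun k => q ^+ (k * k + k + (m * m + 2 * k.+1 * m))).
Proof. by move=> n; rewrite -[q ^+ _]mulr1; apply: vanish_qM; nia. Qed.

(** With j = n - m in the first sum and j = - (m + k + 1) in the second, the exponents are m + j (j
    + 1), j running once over all integers; each value of j (j + 1) is taken twice. *)
Lemma dsq_sum m : fsum (fun n => q ^+ dsq n m) + fsum (fun k => q ^+ (k * k + k + (m * m + 2 * k.+1 * m)))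
  = q ^+ m * dil2 psi *+ 2.
Proof.
elim: m => [|m IH].
  rewrite mul1r -fsum_dil2; last exact: psi_summable.
  have e k : dil2 (q ^+ tri k) = q ^+ (k * k + k).
    by rewrite rmorphXn /= dil2q -exprM triE mulnS addnC.
  by rewrite mulr2n; congr (_ + _); apply: eq_fsum => k; rewrite e;
    congr (q ^+ _); rewrite /dsq; lia.
rewrite exprS -mulrA -mulrnAr -IH mulrDr -!fsumMl ?(fsum_recl (@dsq_summable m.+1)); last 2 first.
- exact: lam_sq_summable.
- exact: dsq_summable.
rewrite (_ : q ^+ dsq 0 m.+1 = q * q ^+ (m * m + 2 * 1 * m)); last first.
  by rewrite -exprS; congr (q ^+ _); rewrite /dsq; lia.
rewrite [X in _ = _ + X]fsum_recl; last by move=> i; apply: vanishMl; apply: lam_sq_summable.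
rewrite addrCA -addrA; congr (_ + (_ + _)).
- by apply: eq_fsum => n; rewrite -exprS; congr (q ^+ _); rewrite /dsq !subSS; lia.
- by apply: eq_fsum => n; rewrite -exprS; congr (q ^+ _); lia.
Qed.

(** Both products become double series with the common denominators (q^2; q^2)_m. Summing over the
    other index first leaves [dsq_sum] for each m. *)
Lemma shell_theta : Sser 0 * (shell + Bser 0) = dil2 psi *+ 2 * Rser 0.
Proof.
rewrite mulrDr Sser_Bser /shell -(fsumMl _ shell_summable).
have -> : fsum (fun n => Sser 0 * (q ^+ n * qoddp n))
   = fsum (fun n => fsum (fun m => q ^+ dsq n m * (q2fact m)^-1)).
  by apply: eq_fsum => n; rewrite mulrC shell_Sser.
have -> : fsum (fun k => q ^+ (k * k + k) * Sser k.+1)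
   = fsum (fun k => fsum (fun m => q ^+ (k * k + k + (m * m + 2 * k.+1 * m)) * (q2fact m)^-1)).
  apply: eq_fsum => k; rewrite -fsumMl; last exact: Sser_summable.
  by apply: eq_fsum => m; rewrite mulrA -exprD.
rewrite fsum_exchange [X in _ + X]fsum_exchange -fsumD /Rser -fsumMl; last exact: Rser_summable.
apply: eq_fsum => m.
have c F : summable F -> fsum (fun n => F n * (q2fact m)^-1) = (q2fact m)^-1 * fsum F.
  by move=> sF; rewrite -fsumMl //; apply: eq_fsum => n; rewrite mulrC.
rewrite (c _ (@dsq_summable m)) (c _ (@lam_sq_summable m)) -mulrDr dsq_sum muln0 muln1; ring.
Qed.

Definition gfun : fps := dil2 euler ^+ 3 * (euler ^+ 2)^-1.

Lemma cf_euler0 : cf euler 0 = 1.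
Proof.
have := euler_qfact (n := 1) (i := 0) isT; rewrite cfB /qfact big_ord1 => /eqP.
by rewrite subr_eq0 => /eqP ->; rewrite cf_1q0.
Qed.

Lemma cf_dil20 f : cf (dil2 f) 0 = cf f 0. Proof. by []. Qed.
Lemma cf_dil50 f : cf (dil5 f) 0 = cf f 0. Proof. by []. Qed.

Lemma dil2_euler_neq0 : dil2 euler != 0.
Proof. by apply/eqP => /(congr1 (cf^~ 0%N)); rewrite cf_dil20 cf_euler0. Qed.

Lemma cf_X0 f k : cf f 0 = 1 -> cf (f ^+ k) 0 = 1.
Proof. by move=> f1; elim: k => // k IH; rewrite exprS cfM0 IH f1. Qed.

Lemma gfun_euler : gfun * euler ^+ 2 = dil2 euler ^+ 3.
Proof. by rewrite mulrVK // fps_unitE // cf_X0 // cf_euler0. Qed.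

Lemma shell_Bser : shell + Bser 0 = dil2 gfun *+ 2.
Proof.
have e2 := dil2_euler_neq0.
apply: (mulfI (expf_neq0 2 e2)).
have eg := congr1 dil2 gfun_euler; rewrite rmorphM !rmorphXn /= in eg.
have ep := congr1 dil2 psi_euler; rewrite rmorphM rmorphXn /= in ep.
have -> : dil2 euler ^+ 2 * (dil2 gfun *+ 2) = dil2 gfun * dil2 euler ^+ 2 *+ 2 by ring.
rewrite eg -Sser_euler.
have -> : Sser 0 * euler * dil2 (dil2 euler) * (shell + Bser 0)
    = euler * dil2 (dil2 euler) * (Sser 0 * (shell + Bser 0)) by ring.
rewrite shell_theta.
have -> : euler * dil2 (dil2 euler) * (dil2 psi *+ 2 * Rser 0)
    = dil2 (dil2 euler) * (dil2 psi * (Rser 0 * euler)) *+ 2 by ring.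
by rewrite Rser_euler ep exprS.
Qed.

Definition neg f := Fps (fun n => (-1) ^+ n * cf f n).

Lemma negB : zmod_morphism neg.
Proof. by move=> f g; apply: fpsP => n /=; rewrite mulrBr. Qed.
Lemma negM : monoid_morphism neg.
Proof.
split=> [|f g]; apply: fpsP => n; first by rewrite /=; case: n => // n; rewrite mulr0.
rewrite -[LHS]/((-1) ^+ n * cf (f * g) n) !cfM mulr_sumr; apply: eq_bigr => i _ /=.
rewrite mulrACA -exprD subnKC -1?ltnS //.
Qed.
HB.instance Definition _ := GRing.isZmodMorphism.Build fps fps neg negB.
HB.instance Definition _ := GRing.isMonoidMorphism.Build fps fps neg negM.

Lemma neg_q : neg q = - q.
Proof. by apply: fpsP => n; rewrite cfN /=; case: n => [|[|n]]; rewrite ?mulr0. Qed.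

Lemma neg_shell : neg shell = Bser 0.
Proof.
have -> : neg shell = fsum (fun n => neg (q ^+ n * qoddp n)).
  by apply: fpsP => n; rewrite /= mulr_sumr.
apply: eq_fsum => n; rewrite rmorphM rmorphXn /= neg_q muln1; congr (_ * _); first exact: exprNn.
rewrite /qoddp rmorph_prod; apply: eq_bigr => i _.
by rewrite rmorphD rmorph1 rmorphXn /= neg_q exprNn exprS exprM sqrrN !expr1n mulr1 mulN1r.
Qed.

Lemma cf_shell_even m : cf shell (2 * m) = cf gfun m.
Proof.
have := congr1 (cf^~ (2 * m)%N) shell_Bser; rewrite -neg_shell cfD cfMn cf_dil2.
rewrite -[cf (neg _) _]/((-1) ^+ (2 * m) * cf shell (2 * m)).
rewrite exprM sqrrN !expr1n mul1r dvdn_mulr // mulKn // -mulr2n.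
by move/eqP; rewrite eqrMn2r //= => /eqP.
Qed.
End Nu.

(** * Quintic relations *)

Section Kappa.
Local Open Scope ring_scope.
(** In the application a, e, b are phi(-q^5), E_5, E_10 and Q is q. The pairs J0, J2 and A, C and U,
    V consist of components modulo 5 of E_1, E_2 and phi. *)
Variables (F : fieldType) (a e b J0 J2 A C U V Q : F).
Hypotheses (a0 : a != 0) (e0 : e != 0) (b0 : b != 0) (J00 : J0 != 0) (A0 : A != 0) (Q0 : Q != 0).
Hypothesis k1 : Q * e * b ^+ 2 != J0 * A ^+ 2.
Hypothesis ab : a * b = e ^+ 2.
Hypothesis J02 : J0 * J2 = - e ^+ 2.
Hypothesis AC : A * C = - b ^+ 2.
Hypothesis R0 : a * A + Q * (U * C) = J0 ^+ 2.
Hypothesis R1 : U * A - Q * (V * b) = - (J0 * e *+ 2).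
Hypothesis R4 : a * C + V * A = J2 ^+ 2.

(* k is Ramanujan's parameter q R(q) R(q^2)^2, R being the Rogers-Ramanujan continued
   fraction, and x is q^(1/5) / R(q). *)
Lemma kappa_param : exists k x : F, [/\ [/\ k != 0, 1 - k != 0, 1 + k != 0 & x != 0],
   J0 = e * x, J2 = - e / x, A = b * x ^+ 2 * (1 - k) / (1 + k)
 & [/\ C = - b * (1 + k) / (x ^+ 2 * (1 - k)),
   Q = k * x ^+ 5 * (1 - k) ^+ 2 / (1 + k) ^+ 2,
   U = - (a *+ 2) / (x * (1 - k)), V = a *+ 2 * (1 + k) / (x ^+ 4 * (1 - k) ^+ 2)
 & b = e ^+ 2 / a]].
Proof.
have [x xE] : exists x, x = J0 / e by exists (J0 / e).
have [X XE'] : exists X, X = A / b by exists (A / b).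
have [k kE] : exists k, k = Q / (x * X ^+ 2) by exists (Q / (x * X ^+ 2)).
have x0 : x != 0 by rewrite xE mulf_neq0 ?invr_eq0.
have X0 : X != 0 by rewrite XE' mulf_neq0 ?invr_eq0.
have k0 : k != 0 by rewrite kE !(mulf_eq0, invr_eq0, expf_eq0) (negbTE Q0) (negbTE x0) (negbTE X0).
have bE : b = e ^+ 2 / a by rewrite -ab; field.
have J0E : J0 = e * x by rewrite xE; field.
have AE : A = b * X by rewrite XE'; field.
have J2E : J2 = - e / x.
  by apply: (mulfI J00); rewrite J02 J0E; field; rewrite ?x0 ?X0 ?a0 ?k0 ?e0 ?b0 //.
have CE : C = - b / X.
  by apply: (mulfI A0); rewrite AC AE; field.
have QE : Q = k * (x * X ^+ 2) by rewrite kE; field; rewrite ?x0 ?X0 ?a0 ?k0 ?e0 ?b0 //.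
(* In the original variables k = Q e b^2 / (J0 A^2), so [k1] excludes k = 1. *)
have k1' : 1 - k != 0.
  apply: contraNneq k1 => /eqP; rewrite subr_eq0 => /eqP k1E.
  by rewrite QE -k1E J0E AE; apply/eqP; ring.
have VE : V = a / (x ^+ 2 * X) + a / X ^+ 2.
  apply: (mulIf A0); have -> : V * A = J2 ^+ 2 - a * C by rewrite -R4; ring.
  rewrite J2E CE AE bE; field; rewrite ?x0 ?X0 ?a0 ?k0 ?e0 ?b0 //.
have UE : U = a * (X - x ^+ 2) / (k * x * X).
  have h : Q * C != 0 by rewrite CE !(mulf_eq0, invr_eq0, oppr_eq0) (negbTE Q0) (negbTE b0) (negbTE X0).
  apply: (mulIf h); have -> : U * (Q * C) = J0 ^+ 2 - a * A by rewrite -R0; ring.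
  rewrite QE J0E CE AE bE; field; rewrite ?x0 ?X0 ?a0 ?k0 ?e0 ?b0 //.
(* [R4] and [R0] have determined V and U. Then [R1] is this relation multiplied by 1 - k and a
   nonzero factor, and it eliminates X. *)
have rel : X * (1 + k) = x ^+ 2 * (1 - k).
  apply: (mulIf k1'); move: R1; rewrite UE VE J0E QE AE bE => R1'.
  have h : e ^+ 2 / (k * x) != 0 by rewrite !(mulf_eq0, invr_eq0, expf_eq0) (negbTE e0) (negbTE x0) (negbTE k0).
  apply: (mulIf h); apply/eqP; rewrite -subr_eq0.
  move/eqP: R1'; rewrite -subr_eq0 => /eqP R1'; apply/eqP; rewrite -[RHS]R1'.
  by field; rewrite ?x0 ?X0 ?a0 ?k0 ?e0 ?b0 //.
have k2 : 1 + k != 0.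
  apply/eqP => k2; move: rel; rewrite k2 mulr0 => /esym/eqP.
  by rewrite mulf_eq0 (negbTE k1') orbF expf_eq0 (negbTE x0).
have XE : X = x ^+ 2 * (1 - k) / (1 + k) by rewrite -rel; field.
exists k, x; split=> //.
- by rewrite AE XE; field.
split=> //.
- by rewrite CE XE; field; rewrite ?x0 ?X0 ?a0 ?k0 ?e0 ?b0 ?k1' ?k2 //.
- by rewrite QE XE; field.
- by rewrite UE XE; field; rewrite ?x0 ?X0 ?a0 ?k0 ?e0 ?b0 ?k1' ?k2 //.
- by rewrite VE XE; field; rewrite ?x0 ?X0 ?a0 ?k0 ?e0 ?b0 ?k1' ?k2 //.
Qed.

Let g := a ^+ 2 + Q * (U * V).

(** After substitution of the parametrisation, this and the next identities are between rational
    functions of k, x, a and e. This one provides the constant term of the quintic. *)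
Lemma kappa_norm : a * (Q * U ^+ 5 + Q ^+ 4 * V ^+ 5)
  = g ^+ 3 - a ^+ 6 + (g - a ^+ 2) * a ^+ 4 *+ 5 - (g - a ^+ 2) ^+ 2 * a ^+ 2 *+ 5.
Proof.
have [k [x [[k0 k1' k2 x0] J0E J2E AE [CE QE UE VE bE]]]] := kappa_param.
rewrite /g UE VE QE; field; rewrite ?x0 ?X0 ?a0 ?k0 ?e0 ?b0 ?k1' ?k2 //.
Qed.

Lemma kappa_T1 : a * (- (a * b ^+ 2) + U * (Q * C ^+ 2) + V * A ^+ 2) = b ^+ 2 * g.
Proof.
have [k [x [[k0 k1' k2 x0] J0E J2E AE [CE QE UE VE bE]]]] := kappa_param.
rewrite /g UE VE QE CE AE bE; field; rewrite ?x0 ?X0 ?a0 ?k0 ?e0 ?b0 ?k1' ?k2 //.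
Qed.

(** p0, ..., p4 are the components modulo 5 of E_1^4. *)
Let p0 := J0 ^+ 4 + Q * (- (e * (J0 * J2 ^+ 2)) *+ 12 - e ^+ 3 * J2 *+ 4).
Let p1 := - (J0 ^+ 3 * e) *+ 4 + Q * (J0 * J2 ^+ 3 *+ 4 + e ^+ 2 * J2 ^+ 2 *+ 6).
Let p2 := J0 ^+ 2 * e ^+ 2 *+ 6 + J0 ^+ 3 * J2 *+ 4 - Q * (e * J2 ^+ 3) *+ 4.
Let p3 := - (J0 * e ^+ 3) *+ 4 - J0 ^+ 2 * e * J2 *+ 12 + Q * J2 ^+ 4.
Let p4 := e ^+ 4 + J0 * e ^+ 2 * J2 *+ 12 + J0 ^+ 2 * J2 ^+ 2 *+ 6.

Lemma kappa_T2 : p4 = - (b ^+ 2 * a ^+ 2) *+ 5.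
Proof.
have [k [x [[k0 k1' k2 x0] J0E J2E AE [CE QE UE VE bE]]]] := kappa_param.
rewrite /p4 J0E J2E bE; field; by rewrite ?a0 ?x0 ?k1' ?k2.
Qed.

Lemma kappa_T3 : a * (p4 * a + p3 * U + p0 * V) =
  b ^+ 2 * (- (a ^+ 4) *+ 25 + a ^+ 2 * g *+ 5 + g ^+ 2).
Proof.
have [k [x [[k0 k1' k2 x0] J0E J2E AE [CE QE UE VE bE]]]] := kappa_param.
rewrite /p4 /p3 /p0 /g J0E J2E UE VE QE bE; field; by rewrite ?a0 ?x0 ?k1' ?k2.
Qed.

Lemma kappa_T4 : p4 * (a ^+ 2 + Q * (U * V) *+ 2) + p3 * (a * U *+ 2) + p2 * U ^+ 2
   + p1 * (Q * V ^+ 2) + p0 * (a * V *+ 2) = - (b ^+ 2 * a ^+ 4) *+ 25.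
Proof.
have [k [x [[k0 k1' k2 x0] J0E J2E AE [CE QE UE VE bE]]]] := kappa_param.
rewrite /p4 /p3 /p2 /p1 /p0 J0E J2E UE VE QE bE; field; by rewrite ?a0 ?x0 ?k1' ?k2.
Qed.
End Kappa.

(** * Products and comparison of 5-dissections *)

Section QuinticAlgebra.
Local Open Scope ring_scope.

Lemma diss_mul c0 c1 c2 c3 c4 d0 d1 d2 d3 d4 :
  diss c0 c1 c2 c3 c4 * diss d0 d1 d2 d3 d4 =
  diss (c0 * d0 + q * (c1 * d4 + c2 * d3 + c3 * d2 + c4 * d1))
       (c0 * d1 + c1 * d0 + q * (c2 * d4 + c3 * d3 + c4 * d2))
       (c0 * d2 + c1 * d1 + c2 * d0 + q * (c3 * d4 + c4 * d3))
       (c0 * d3 + c1 * d2 + c2 * d1 + c3 * d0 + q * (c4 * d4))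
       (c0 * d4 + c1 * d3 + c2 * d2 + c3 * d1 + c4 * d0).
Proof. by rewrite /diss !(rmorphD, rmorphM) /= dil5q; ring. Qed.

Lemma diss_inj c0 c1 c2 c3 c4 d0 d1 d2 d3 d4 :
  diss c0 c1 c2 c3 c4 = diss d0 d1 d2 d3 d4 -> [/\ c0 = d0, c1 = d1, c2 = d2, c3 = d3 & c4 = d4].
Proof.
move=> h; have s r : (r < 5)%N -> nth 0 [:: c0; c1; c2; c3; c4] r = nth 0 [:: d0; d1; d2; d3; d4] r.
  by move=> r5; rewrite -(@sect_diss r) // h sect_diss.
by split; [apply: (s 0%N)|apply: (s 1%N)|apply: (s 2)|apply: (s 3)|apply: (s 4)].
Qed.

Lemma diss_eq c0 c1 c2 c3 c4 d0 d1 d2 d3 d4 : c0 = d0 -> c1 = d1 -> c2 = d2 -> c3 = d3 ->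
  c4 = d4 -> diss c0 c1 c2 c3 c4 = diss d0 d1 d2 d3 d4.
Proof. by move=> -> -> -> -> ->. Qed.

Lemma fps_mulIn k (f h : fps) : f *+ k.+1 = h *+ k.+1 -> f = h.
Proof.
move=> eqk; apply: fpsP => i; have := congr1 (cf^~ i) eqk; rewrite !cfMn.
by move/eqP; rewrite eqrMn2r /= => /eqP.
Qed.

Lemma unit_neq0 (f : fps) : f \is a GRing.unit -> f != 0.
Proof. by apply: contraTneq => ->; rewrite unitr0. Qed.
End QuinticAlgebra.

(** * The quintic for phi and the resulting recurrences *)

Section Quintic.
Local Open Scope ring_scope.

(* ph and eu stand for phi and euler.  They, and all the series built from them, are
   variables here because unification would otherwise unfold them. *)
Variables (ph eu : fps).
Hypothesis ph1 : cf ph 0 = 1.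
Hypothesis eu1 : cf eu 0 = 1.
Hypothesis ph_eu : ph * dil2 eu = eu ^+ 2.
Hypothesis ph2_sect0 : sect 0 (ph ^+ 2) = ph ^+ 2 *+ 2 - dil5 ph ^+ 2.
Variables (U V J0 J2 a e b A C g E : fps).
Hypotheses (aE : a = dil5 ph) (eE : e = dil5 eu) (EE : E = dil2 eu) (bE : b = dil5 E).
Hypotheses (AE : A = dil2 J0) (CE : C = dil2 J2) (gE : g = ph ^+ 2).
Hypothesis phE : ph = diss a U 0 0 V.
Hypothesis euE : eu = diss J0 (- e) J2 0 0.

(** Replacing q by q^2 in the dissection of E_1 sends the residues 0, 1, 2 to 0, 2, 4. *)
Lemma E_diss : E = diss A 0 (- b) 0 C.
Proof.
have -> : b = dil2 e by rewrite bE EE eE dil25.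
rewrite EE {1}euE AE CE /diss !(rmorphD, rmorphM, rmorphN, rmorphXn, rmorph0) /= !dil25 dil2q.
by ring.
Qed.

Lemma E2_diss : E ^+ 2 = diss (A ^+ 2) (- (q * (b * C)) *+ 2) (- (A * b) *+ 2)
  (q * C ^+ 2) (b ^+ 2 + A * C *+ 2).
Proof. by rewrite expr2 E_diss diss_mul; apply: diss_eq; ring. Qed.

Lemma eu2_diss : eu ^+ 2 = diss (J0 ^+ 2) (- (J0 * e) *+ 2) (e ^+ 2 + J0 * J2 *+ 2)
  (- (e * J2) *+ 2) (J2 ^+ 2).
Proof. by rewrite expr2 euE diss_mul; apply: diss_eq; ring. Qed.

Lemma ab : a * b = e ^+ 2.
Proof. by rewrite aE bE EE eE -rmorphXn -ph_eu rmorphM. Qed.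

(** Compares components in phi E_2 = E_1^2. Index 2 reads - a b = e^2 + 2 J0 J2, whence J0 J2 = -
    e^2 by [ab]; replacing q by q^2 there gives the relation for A C. *)
Lemma class_rel : [/\ a * A + q * (U * C) = J0 ^+ 2, U * A - q * (V * b) = - (J0 * e *+ 2),
  J0 * J2 = - e ^+ 2, a * C + V * A = J2 ^+ 2 & A * C = - b ^+ 2].
Proof.
have := ph_eu; rewrite -EE eu2_diss phE E_diss diss_mul => /diss_inj[h0 h1 h2 h3 h4].
have J02 : J0 * J2 = - e ^+ 2.
  apply: (@fps_mulIn 1); move: h2; rewrite mulrN ab => h2.
  have -> : J0 * J2 *+ 2 = (e ^+ 2 + J0 * J2 *+ 2) - e ^+ 2 by ring.
  by rewrite -h2; ring.
split=> //.
- by rewrite -h0; ring.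
- by rewrite -mulNrn -h1; ring.
- by rewrite -h4; ring.
- have := congr1 dil2 J02; rewrite rmorphM rmorphN rmorphXn /= -AE -CE => ->.
  by rewrite bE EE eE dil25.
Qed.

Lemma ph2_diss : ph ^+ 2 = diss (a ^+ 2 + q * (U * V) *+ 2) (a * U *+ 2) (U ^+ 2) (q * V ^+ 2) (a * V *+ 2).
Proof. by rewrite expr2 phE diss_mul; apply: diss_eq; ring. Qed.

(** The component of index 0 of phi^2 is a^2 + 2 q U V by squaring, and 2 phi^2 - a^2 by sums of two
    squares. Thus phi^2 itself, undilated, enters the relations between components. *)
Lemma g_diss : g = a ^+ 2 + q * (U * V).
Proof.
apply: (@fps_mulIn 1); have := ph2_sect0; rewrite {1}ph2_diss sect_diss //= -gE -aE => h.
have -> : g *+ 2 = (g *+ 2 - a ^+ 2) + a ^+ 2 by ring.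
by rewrite -h; ring.
Qed.

Lemma neq0s : [/\ a != 0, e != 0, b != 0, J0 != 0 & [/\ A != 0, q != 0 & q * e * b ^+ 2 != J0 * A ^+ 2]].
Proof.
have j0 : cf J0 0 = 1.
  have := eu1; rewrite euE /diss !cfD !rmorph0 !mulr0 !cf0 !addr0.
  by rewrite cf_qM cf_qXM !addr0.
have neq0 f : cf f 0 = 1 -> f != 0 by move=> f1; apply: unit_neq0; apply: fps_unitE.
split; try by apply: neq0; rewrite ?aE ?eE ?bE ?EE ?cf_dil50 ?cf_dil20.
split; first by apply: neq0; rewrite AE cf_dil20.
- by apply/eqP => /(congr1 (cf^~ 1%N)).
(* The constant terms of the two sides are 0 and 1. *)
- apply/eqP => /(congr1 (cf^~ 0%N)); rewrite -mulrA cf_qM cfM0 j0 mul1r cf_X0 // AE cf_dil20 //.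
Qed.
Lemma ph_unit : ph \is a GRing.unit.
Proof. exact: fps_unitE. Qed.

Variables (F : fieldType) (iota : {rmorphism fps -> F}).
Hypothesis iota_inj : injective iota.
Local Notation "x %:F" := (iota x).

Let iE := (rmorphXn, rmorphMn, rmorphN, rmorphM, rmorphD).

Lemma iota_eq0 x : (x%:F == 0) = (x == 0).
Proof. by rewrite -(rmorph0 iota) (inj_eq iota_inj). Qed.

(** Continuation form: each relation proved in [F] receives all the hypotheses of the
    parametrisation at once. *)
Lemma kappa_hyps (T : Prop) : (a%:F != 0 -> e%:F != 0 -> b%:F != 0 -> J0%:F != 0 -> A%:F != 0 ->
  q%:F != 0 -> q%:F * e%:F * b%:F ^+ 2 != J0%:F * A%:F ^+ 2 -> a%:F * b%:F = e%:F ^+ 2 ->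
  J0%:F * J2%:F = - e%:F ^+ 2 -> A%:F * C%:F = - b%:F ^+ 2 ->
  a%:F * A%:F + q%:F * (U%:F * C%:F) = J0%:F ^+ 2 ->
  U%:F * A%:F - q%:F * (V%:F * b%:F) = - (J0%:F * e%:F *+ 2) ->
  a%:F * C%:F + V%:F * A%:F = J2%:F ^+ 2 -> T) -> T.
Proof.
have [h1 h2 h3 h4 h5] := class_rel; have [n1 n2 n3 n4 [n5 n6 n7]] := neq0s.
move/eqP: n7 => n7; have h6 := ab.
have tr (x y : fps) : x = y -> x%:F = y%:F by move=> ->.
move: (tr _ _ h1) (tr _ _ h2) (tr _ _ h3) (tr _ _ h4) (tr _ _ h5) (tr _ _ h6).
rewrite !iE => k1 k2 k3 k4 k5 k6.
apply; rewrite ?iota_eq0 //.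
by apply/eqP => k7; apply: n7; apply: iota_inj; rewrite !iE.
Qed.

Lemma norm_rel : a * (q * U ^+ 5 + q ^+ 4 * V ^+ 5) = g ^+ 3 - a ^+ 6
  + (g - a ^+ 2) * a ^+ 4 *+ 5 - (g - a ^+ 2) ^+ 2 * a ^+ 2 *+ 5.
Proof.
apply: iota_inj; apply: kappa_hyps => n1 n2 n3 n4 n5 n6 n7 h1 h2 h3 h4 h5 h6.
rewrite g_diss !iE.
exact: (kappa_norm n1 n2 n3 n4 n5 n6 n7 h1 h2 h3 h4 h5 h6).
Qed.

Lemma sect_E2_0 : sect 4 (E ^+ 2) = - b ^+ 2.
Proof. by rewrite E2_diss sect_diss //=; have [_ _ _ _ ->] := class_rel; ring. Qed.

Lemma sect_E2_1 : a * sect 4 (E ^+ 2 * ph) = b ^+ 2 * g.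
Proof.
rewrite E2_diss phE diss_mul sect_diss //=; have [_ _ _ _ ->] := class_rel.
rewrite [X in a * X = _](_ : _ = - (a * b ^+ 2) + U * (q * C ^+ 2) + V * A ^+ 2); last by ring.
apply: iota_inj; apply: kappa_hyps => n1 n2 n3 n4 n5 n6 n7 h1 h2 h3 h4 h5 h6.
rewrite g_diss !iE.
exact: (kappa_T1 n1 n2 n3 n4 n5 n6 n7 h1 h2 h3 h4 h5 h6).
Qed.

Let p0 := J0 ^+ 4 + q * (- (e * (J0 * J2 ^+ 2)) *+ 12 - e ^+ 3 * J2 *+ 4).
Let p1 := - (J0 ^+ 3 * e) *+ 4 + q * (J0 * J2 ^+ 3 *+ 4 + e ^+ 2 * J2 ^+ 2 *+ 6).
Let p2 := J0 ^+ 2 * e ^+ 2 *+ 6 + J0 ^+ 3 * J2 *+ 4 - q * (e * J2 ^+ 3) *+ 4.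
Let p3 := - (J0 * e ^+ 3) *+ 4 - J0 ^+ 2 * e * J2 *+ 12 + q * J2 ^+ 4.
Let p4 := e ^+ 4 + J0 * e ^+ 2 * J2 *+ 12 + J0 ^+ 2 * J2 ^+ 2 *+ 6.

Lemma eu4_diss : (eu ^+ 2) ^+ 2 = diss p0 p1 p2 p3 p4.
Proof. by rewrite eu2_diss expr2 diss_mul; apply: diss_eq; rewrite /p0 /p1 /p2 /p3 /p4; ring. Qed.

(** Trades E_2^2 phi^2 for E_1^4, whose components only involve e, J0, J2 and q. *)
Lemma E2ph2 k : E ^+ 2 * ph ^+ k.+2 = (eu ^+ 2) ^+ 2 * ph ^+ k.
Proof. by rewrite -ph_eu -EE !exprS; ring. Qed.

Lemma sect_E2_2 : sect 4 (E ^+ 2 * ph ^+ 2) = - (b ^+ 2 * a ^+ 2) *+ 5.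
Proof.
rewrite E2ph2 mulr1 eu4_diss sect_diss //=.
apply: iota_inj; apply: kappa_hyps => n1 n2 n3 n4 n5 n6 n7 h1 h2 h3 h4 h5 h6.
rewrite /p4 !iE.
exact: (kappa_T2 n1 n2 n3 n4 n5 n6 n7 h1 h2 h3 h4 h5 h6).
Qed.

Lemma sect_E2_3 : a * sect 4 (E ^+ 2 * ph ^+ 3) = b ^+ 2 * (- (a ^+ 4) *+ 25 + a ^+ 2 * g *+ 5 + g ^+ 2).
Proof.
rewrite E2ph2 eu4_diss expr1 phE diss_mul sect_diss //=.
rewrite [X in a * X = _](_ : _ = p4 * a + p3 * U + p0 * V); last by ring.
apply: iota_inj; apply: kappa_hyps => n1 n2 n3 n4 n5 n6 n7 h1 h2 h3 h4 h5 h6.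
rewrite g_diss /p4 /p3 /p0 !iE.
exact: (kappa_T3 n1 n2 n3 n4 n5 n6 n7 h1 h2 h3 h4 h5 h6).
Qed.

Lemma sect_E2_4 : sect 4 (E ^+ 2 * ph ^+ 4) = - (b ^+ 2 * a ^+ 4) *+ 25.
Proof.
rewrite E2ph2 eu4_diss ph2_diss diss_mul sect_diss //=.
rewrite [LHS](_ : _ = p4 * (a ^+ 2 + q * (U * V) *+ 2) + p3 * (a * U *+ 2) + p2 * U ^+ 2
   + p1 * (q * V ^+ 2) + p0 * (a * V *+ 2)); last by ring.
apply: iota_inj; apply: kappa_hyps => n1 n2 n3 n4 n5 n6 n7 h1 h2 h3 h4 h5 h6.
rewrite /p4 /p3 /p2 /p1 /p0 !iE.
exact: (kappa_T4 n1 n2 n3 n4 n5 n6 n7 h1 h2 h3 h4 h5 h6).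
Qed.

Variable n : fps.
Hypothesis an : a * n = g ^+ 3.
(** Dilated by 5, the series 5 a, e2, e3, e4 and n = phi^6 / a are the elementary symmetric
    functions of the five conjugates phi(-z q), z^5 = 1. *)
Let e2 := a ^+ 2 *+ 15 - g *+ 5.
Let e3 := a ^+ 3 *+ 25 - g * a *+ 15.
Let e4 := a ^+ 4 *+ 25 - g * a ^+ 2 *+ 25 + g ^+ 2 *+ 5.

Lemma ann x : a * (n * x) = g ^+ 3 * x.
Proof. by rewrite mulrA an. Qed.

Lemma gX_ann k x : g ^+ (k + 3) * x = g ^+ k * (a * (n * x)).
Proof. by rewrite ann exprD mulrA. Qed.

(* Characteristic polynomial of multiplication by ph over the series in q^5. *)
Lemma ph_charpoly : ph ^+ 5 - dil5 a * ph ^+ 4 *+ 5 + dil5 e2 * ph ^+ 3 - dil5 e3 * ph ^+ 2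
  + dil5 e4 * ph = dil5 n.
Proof.
have da0 : dil5 a != 0 by apply: unit_neq0; apply: fps_unitE; rewrite aE !cf_dil50.
apply: (mulfI da0); rewrite -rmorphM an.
have -> : g ^+ 3 = a * (q * U ^+ 5 + q ^+ 4 * V ^+ 5) + a ^+ 6
  - (g - a ^+ 2) * a ^+ 4 *+ 5 + (g - a ^+ 2) ^+ 2 * a ^+ 2 *+ 5 by rewrite norm_rel; ring.
rewrite /e2 /e3 /e4 g_diss {1 2 3 4 5}phE /diss !(rmorphXn, rmorphMn, rmorphN, rmorphM, rmorphD, rmorph0) /= dil5q.
ring.
Qed.

(** Series in q^5 pass through U_r, so the quintic becomes a recurrence for U_r (h phi^j). It is run
    downwards, to reach negative powers of phi. *)
Lemma sect_charpoly r h : (r < 5)%N -> n * sect r h = sect r (h * ph ^+ 5)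
  - a * sect r (h * ph ^+ 4) *+ 5 + e2 * sect r (h * ph ^+ 3) - e3 * sect r (h * ph ^+ 2)
  + e4 * sect r (h * ph ^+ 1).
Proof.
move=> r5; rewrite -!sectM // -ph_charpoly -sectMn -!(sectD, sectB); congr sect; ring.
Qed.

Variable W : fps.
Hypothesis phW : ph * W = 1.

Lemma phWX k m : ph ^+ (k + m) * W ^+ k = ph ^+ m.
Proof. by rewrite addnC exprD -mulrA -exprMn phW expr1n mulr1. Qed.

Lemma ph_neq0 : ph != 0. Proof. exact: unit_neq0 ph_unit. Qed.
Lemma g_neq0 : g != 0. Proof. by rewrite gE expf_neq0 // ph_neq0. Qed.

Lemma WphX h k m : h * W ^+ k * ph ^+ (k + m) = h * ph ^+ m.
Proof. by rewrite -(phWX k m); ring. Qed.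

Variable S : nat -> fps.
Hypothesis SE : forall j, S j = sect 4 (E ^+ 2 * W ^+ j).

(** The recurrence for h = E_2^2 / phi gives n S_1 in terms of U_4 (E_2^2 phi^j) for 0 <= j <= 4. *)
Lemma S1E : g * S 1 = a * b ^+ 2 *+ 5.
Proof.
rewrite SE.
(* The factor g^2 turns the left side into g^3 S_1 = a n S_1. *)
apply: (mulfI (expf_neq0 2 g_neq0)); rewrite mulrA -exprSr -an -mulrA (sect_charpoly _ (isT : 4 < 5)%N).
rewrite (WphX _ 1 4) (WphX _ 1 3) (WphX _ 1 2) (WphX _ 1 1) (WphX _ 1 0) expr0 mulr1.
rewrite sect_E2_4 sect_E2_2 sect_E2_0 expr1.
rewrite [LHS](_ : _ = a * (- (b ^+ 2 * a ^+ 4) *+ 25) - a * (a * sect 4 (E ^+ 2 * ph ^+ 3)) *+ 5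
  + e2 * a * (- (b ^+ 2 * a ^+ 2) *+ 5) - e3 * (a * sect 4 (E ^+ 2 * ph)) - e4 * a * b ^+ 2); last by ring.
by rewrite sect_E2_3 sect_E2_1 /e2 /e3 /e4; ring.
Qed.

(** The recurrence one step further down, with S_1 among its inputs; [S3E] takes the next step. *)
Lemma S2E : g ^+ 4 * S 2 =
  b ^+ 2 * (- (g ^+ 3) *+ 4 + a ^+ 2 * g ^+ 2 *+ 30 - a ^+ 4 * g *+ 100 + a ^+ 6 *+ 125).
Proof.
have := congr1 (fun x => g * (a * x)) (sect_charpoly (E ^+ 2 * W ^+ 2) (isT : 4 < 5)%N).
rewrite (WphX _ 2 3) (WphX _ 2 2) (WphX _ 2 1) (WphX _ 2 0) expr0 expr1 mulr1.
have -> : E ^+ 2 * W ^+ 2 * ph = E ^+ 2 * W ^+ 1 by rewrite -(mulr1 (W ^+ 1)) -phW; ring.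
rewrite -(SE 1) -(SE 2) sect_E2_2 sect_E2_0 [a * (n * _)]mulrA an [g * (_ * _)]mulrA -exprS => ->.
rewrite [LHS](_ : _ = g * (a * sect 4 (E ^+ 2 * ph ^+ 3)) - g * a * a * (- (b ^+ 2 * a ^+ 2) *+ 5) *+ 5
  + g * e2 * (a * sect 4 (E ^+ 2 * ph)) + g * e3 * a * b ^+ 2 + a * e4 * (g * S 1)); last by ring.
by rewrite sect_E2_3 sect_E2_1 S1E /e2 /e3 /e4; ring.
Qed.

Lemma S3E : g ^+ 7 * S 3 = b ^+ 2 * (- (a * g ^+ 5) *+ 20 + a ^+ 3 * g ^+ 4 *+ 305
  - a ^+ 5 * g ^+ 3 *+ 1475 + a ^+ 7 * g ^+ 2 *+ 3875 - a ^+ 9 * g *+ 5625 + a ^+ 11 *+ 3125).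
Proof.
have := congr1 (fun x => g ^+ 4 * (a * x)) (sect_charpoly (E ^+ 2 * W ^+ 3) (isT : 4 < 5)%N).
rewrite (WphX _ 3 2) (WphX _ 3 1) (WphX _ 3 0) expr0 mulr1.
have -> : E ^+ 2 * W ^+ 3 * ph ^+ 2 = E ^+ 2 * W ^+ 1.
  by rewrite -[RHS]mulr1 -(expr1n _ 2) -phW; ring.
have -> : E ^+ 2 * W ^+ 3 * ph ^+ 1 = E ^+ 2 * W ^+ 2.
  by rewrite -[RHS]mulr1 -phW; ring.
rewrite -(SE 1) -(SE 2) -(SE 3) sect_E2_2 sect_E2_0 expr1 => h.
apply: (etrans (gX_ann 4 (S 3))); apply: (etrans h).
rewrite [LHS](_ : _ = g ^+ 4 * a * (- (b ^+ 2 * a ^+ 2) *+ 5) - g ^+ 4 * a * (a * sect 4 (E ^+ 2 * ph)) *+ 5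
  - g ^+ 4 * e2 * a * b ^+ 2 - g ^+ 3 * e3 * a * (g * S 1) + a * e4 * (g ^+ 4 * S 2)); last by ring.
by rewrite S2E sect_E2_1 S1E /e2 /e3 /e4; ring.
Qed.

Let Y := dil5 a * ph ^+ 4 - dil5 (a ^+ 2 *+ 3 - g) * ph ^+ 3 + dil5 (a ^+ 3 *+ 5 - g * a *+ 3) * ph ^+ 2
  - dil5 (a ^+ 4 *+ 5 - g * a ^+ 2 *+ 5 + g ^+ 2) * ph.

(** All intermediate coefficients of the quintic are divisible by 5. *)
Lemma ph5 : ph ^+ 5 = dil5 n + Y *+ 5.
Proof.
rewrite -ph_charpoly /Y.
have -> : e2 = (a ^+ 2 *+ 3 - g) *+ 5 by rewrite /e2; ring.
have -> : e3 = (a ^+ 3 *+ 5 - g * a *+ 3) *+ 5 by rewrite /e3; ring.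
have -> : e4 = (a ^+ 4 *+ 5 - g * a ^+ 2 *+ 5 + g ^+ 2) *+ 5 by rewrite /e4; ring.
by rewrite !(rmorphMn dil5) /=; ring.
Qed.

Lemma n_unit : n * (a * W ^+ 6) = 1.
Proof. by rewrite mulrA [n * a]mulrC an gE -exprM (phWX 6 0). Qed.

(* 1 / ph^5 is congruent to a series in q^5 modulo 5. *)
Lemma sect_divph5 r h : (r < 5)%N -> exists f,
  sect r (h * W ^+ 5) = sect r h * (a * W ^+ 6) + f *+ 5.
Proof.
move=> r5; exists (- (sect r (h * W ^+ 5 * Y) * (a * W ^+ 6))).
have -> : sect r h = n * sect r (h * W ^+ 5) + sect r (h * W ^+ 5 * Y) *+ 5.
  rewrite -sectM // -sectMn -sectD; congr sect.
  rewrite -[h in LHS]mulr1 -(expr0 ph) -(phWX 5 0) ph5; ring.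
rewrite [RHS](_ : _ = sect r (h * W ^+ 5) * (n * (a * W ^+ 6))); last by ring.
by rewrite n_unit mulr1.
Qed.

Lemma sect0_ph : sect 0 (ph ^+ 1) = a /\ sect 0 (ph ^+ 2) = g *+ 2 - a ^+ 2 /\
  sect 0 (ph ^+ 3) = a * g *+ 6 - a ^+ 3 *+ 5 /\ sect 0 (ph ^+ 4) = g ^+ 2 *+ 6 - a ^+ 4 *+ 5.
Proof.
split; first by rewrite expr1 phE sect_diss.
split; first by rewrite ph2_sect0 -gE -aE.
split; first by rewrite exprS ph2_diss {1}phE diss_mul sect_diss //= g_diss; ring.
by rewrite (exprD ph 2 2) ph2_diss diss_mul sect_diss //= g_diss; ring.
Qed.

Lemma sect0_one : sect 0 1 = 1.
Proof.
have e1 : diss 1 0 0 0 0 = 1 by rewrite /diss rmorph1 !rmorph0; ring.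
by rewrite -{1}e1 sect_diss.
Qed.

(** Two steps down of the recurrence for U_0, starting from [sect0_ph] and [sect0_one]. *)
Lemma sect0_W2 : g ^+ 6 * sect 0 (W ^+ 2) = a ^+ 2 * g ^+ 4 *+ 11 - a ^+ 4 * g ^+ 3 *+ 60
  + a ^+ 6 * g ^+ 2 *+ 175 - a ^+ 8 * g *+ 250 + a ^+ 10 *+ 125.
Proof.
have [m1 [m2 [m3 m4]]] := sect0_ph.
have := congr1 (fun x => a * x) (sect_charpoly (1 * W ^+ 1) (isT : 0 < 5)%N).
rewrite (WphX _ 1 4) (WphX _ 1 3) (WphX _ 1 2) (WphX _ 1 1) (WphX _ 1 0) expr0 !mul1r sect0_one m1 m2 m3 m4.
rewrite mulrA an => h1.
have := congr1 (fun x => g ^+ 3 * (a * x)) (sect_charpoly (1 * W ^+ 2) (isT : 0 < 5)%N).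
rewrite (WphX _ 2 3) (WphX _ 2 2) (WphX _ 2 1) (WphX _ 2 0) expr0 !mul1r sect0_one m1 m2 m3.
have -> : W ^+ 2 * ph ^+ 1 = W ^+ 1 by rewrite -[RHS]mulr1 -phW; ring.
move=> h; apply: (etrans (gX_ann 3 _)); apply: (etrans h).
rewrite [LHS](_ : _ = g ^+ 3 * a * (a * g *+ 6 - a ^+ 3 *+ 5 - a * (g *+ 2 - a ^+ 2) *+ 5 + e2 * a - e3)
  + a * e4 * (g ^+ 3 * sect 0 (W ^+ 1))); last by ring.
by rewrite h1 /e2 /e3 /e4; ring.
Qed.

(* The product g W^2 is kept as a variable x so that it can be replaced by 1 after [ring]. *)
Lemma gW2 : exists2 x, x = g * W ^+ 2 & x = 1.
Proof. by exists (g * W ^+ 2) => //; rewrite gE -exprMn phW expr1n. Qed.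

Lemma S1W : S 1 = a * b ^+ 2 * W ^+ 2 *+ 5.
Proof.
have [x xE x1] := gW2; have h := congr1 (fun y => W ^+ 2 * y) S1E.
apply: (etrans (_ : _ = W ^+ 2 * (g * S 1))); last by apply: (etrans h); ring.
transitivity (x * S 1); first by rewrite x1 mul1r.
by rewrite xE; ring.
Qed.

(** Modulo 25 two terms of [S3E] remain: 1475, 3875, 5625 and 3125 are multiples of 25. *)
Lemma S3W : exists f, S 3 = b ^+ 2 * (- (a * W ^+ 4) *+ 20 + a ^+ 3 * W ^+ 6 *+ 305) + f *+ 25.
Proof.
exists (b ^+ 2 * (- (a ^+ 5 * W ^+ 8) *+ 59 + a ^+ 7 * W ^+ 10 *+ 155 - a ^+ 9 * W ^+ 12 *+ 225
  + a ^+ 11 * W ^+ 14 *+ 125)).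
have [x xE x1] := gW2; have h := congr1 (fun y => W ^+ 14 * y) S3E.
apply: (etrans (_ : _ = W ^+ 14 * (g ^+ 7 * S 3))); last apply: (etrans h).
  transitivity (x ^+ 7 * S 3); first by rewrite x1 expr1n mul1r.
  by rewrite xE; ring.
transitivity (b ^+ 2 * (- (a * x ^+ 5 * W ^+ 4) *+ 20 + a ^+ 3 * x ^+ 4 * W ^+ 6 *+ 305
  - a ^+ 5 * x ^+ 3 * W ^+ 8 *+ 1475 + a ^+ 7 * x ^+ 2 * W ^+ 10 *+ 3875
  - a ^+ 9 * x * W ^+ 12 *+ 5625 + a ^+ 11 * W ^+ 14 *+ 3125)); first by rewrite xE; ring.
by rewrite x1; ring.
Qed.

(** Since a b^2 is the dilation of phi E_2^2, U_0 acts on 1 / phi^2 alone. With the factor 5 of S_1,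
    the last three coefficients of [sect0_W2] become multiples of 125. *)
Lemma sect0_S1 : exists f0 f1 f2, sect 0 (S 1) = E ^+ 2 * (a ^+ 2 * W ^+ 3 *+ 55 - a ^+ 4 * W ^+ 5 *+ 300)
  + (dil5 f0 * (E ^+ 2 * W ^+ 7) + dil5 f1 * (E ^+ 2 * W ^+ 9) + dil5 f2 * (E ^+ 2 * W ^+ 11)) *+ 125.
Proof.
exists (ph ^+ 6 *+ 7), (- (ph ^+ 8 *+ 10)), (ph ^+ 10 *+ 5).
rewrite S1W sectMn !(rmorphXn dil5, rmorphMn dil5, rmorphN dil5) /= -aE.
have -> : sect 0 (a * b ^+ 2 * W ^+ 2) = ph * E ^+ 2 * sect 0 (W ^+ 2).
  by rewrite aE bE -(rmorphXn dil5) -(rmorphM dil5) sectM.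
have [x xE x1] := gW2; have h := congr1 (fun y => ph * E ^+ 2 * W ^+ 12 * y *+ 5) sect0_W2.
apply: (etrans (_ : _ = ph * E ^+ 2 * W ^+ 12 * (g ^+ 6 * sect 0 (W ^+ 2)) *+ 5)); last apply: (etrans h).
  transitivity (x ^+ 6 * (ph * E ^+ 2 * sect 0 (W ^+ 2) *+ 5)); first by rewrite x1 expr1n mul1r.
  by rewrite xE; ring.
have [y yE y1] : exists2 y, y = ph * W & y = 1 by exists (ph * W).
transitivity (E ^+ 2 * (a ^+ 2 * x ^+ 4 * y * W ^+ 3 *+ 55 - a ^+ 4 * x ^+ 3 * y * W ^+ 5 *+ 300
  + a ^+ 6 * x ^+ 2 * y * W ^+ 7 *+ 875 - a ^+ 8 * x * y * W ^+ 9 *+ 1250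
  + a ^+ 10 * y * W ^+ 11 *+ 625)); first by rewrite xE yE; ring.
by rewrite x1 y1; ring.
Qed.

Lemma sect4_lin k1 k2 k3 f0 f1 f2 f3 f4 h0 h1 h2 h3 h4 :
  sect 4 (dil5 f0 * h0 *+ k1 - dil5 f1 * h1 *+ k2 + (dil5 f2 * h2 + dil5 f3 * h3 + dil5 f4 * h4) *+ k3)
  = f0 * sect 4 h0 *+ k1 - f1 * sect 4 h1 *+ k2 + (f2 * sect 4 h2 + f3 * sect 4 h3 + f4 * sect 4 h4) *+ k3.
Proof.
rewrite sectD sectB 3!sectMn; rewrite (sectD 4 (dil5 f2 * h2 + dil5 f3 * h3)) (sectD 4 (dil5 f2 * h2)).
by rewrite (sectM f0) // (sectM f1) // (sectM f2) // (sectM f3) // (sectM f4).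
Qed.

(** Up to multiples of 125, U_4 yields 55 g S_3 - 300 g^2 S_5. As 5 divides 55 and 25 divides 300,
    it is enough to know S_3 modulo 25 and S_5 modulo 5. *)
Lemma sect4_S1 : exists f, sect 4 (sect 0 (S 1)) =
  b ^+ 2 * (a ^+ 3 * W ^+ 4 - a * W ^+ 2 *+ 2) *+ 25 + f *+ 125.
Proof.
have [f0 [f1 [f2 ->]]] := sect0_S1; have [f3 h3] := S3W.
have [f5 h5] := sect_divph5 (E ^+ 2) (isT : 4 < 5)%N.
have -> : E ^+ 2 * (a ^+ 2 * W ^+ 3 *+ 55 - a ^+ 4 * W ^+ 5 *+ 300)
  = dil5 g * (E ^+ 2 * W ^+ 3) *+ 55 - dil5 (g ^+ 2) * (E ^+ 2 * W ^+ 5) *+ 300.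
  by rewrite gE -exprM !(rmorphXn dil5) /= -aE; ring.
(* The integers come from 55 . 20 - 300 = 50 + 6 . 125, 55 . 305 = 25 + 134 . 125, 55 . 25 = 11 .
   125 and 300 . 5 = 12 . 125. *)
exists (b ^+ 2 * (- (a * W ^+ 2) *+ 6 + a ^+ 3 * W ^+ 4 *+ 134) + g * f3 *+ 11 - g ^+ 2 * f5 *+ 12
  + (f0 * S 7 + f1 * S 9 + f2 * S 11)).
have gen (Z : nat -> fps) : (forall j, S j = sect 4 (Z j)) ->
    sect 4 (dil5 g * Z 3 *+ 55 - dil5 (g ^+ 2) * Z 5 *+ 300
    + (dil5 f0 * Z 7 + dil5 f1 * Z 9 + dil5 f2 * Z 11) *+ 125) =
    g * S 3 *+ 55 - g ^+ 2 * S 5 *+ 300 + (f0 * S 7 + f1 * S 9 + f2 * S 11) *+ 125.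
  by move=> ZE; rewrite !ZE; apply: sect4_lin.
apply: (etrans (gen _ SE)).
have {}h5 : S 5 = - b ^+ 2 * (a * W ^+ 6) + f5 *+ 5 by rewrite SE h5 sect_E2_0.
rewrite h3 h5.
have [x xE x1] := gW2.
transitivity (b ^+ 2 * (- (a * x * W ^+ 2) *+ 1100 + a ^+ 3 * x * W ^+ 4 *+ 16775
   + x ^+ 2 * a * W ^+ 2 *+ 300) + g * f3 *+ 1375 - g ^+ 2 * f5 *+ 1500
  + (f0 * S 7 + f1 * S 9 + f2 * S 11) *+ 125); first by rewrite xE; ring.
by rewrite x1; ring.
Qed.

(** Writing 1 / phi^4 = phi / phi^5 and 1 / phi^2 = phi^3 / phi^5, modulo 5 only U_r (phi) and U_r
    (phi^3) matter. For these r the latter is 3 phi^2 U_r (phi), so the bracket acquires the factor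
    1 - 2 . 3 = - 5. *)
Lemma sect_r_S1 r : (r == 1%N) || (r == 4) ->
  exists f, sect r (sect 4 (sect 0 (S 1))) = f *+ 125.
Proof.
move=> hr; have r5 : (r < 5)%N by case/orP: hr => /eqP ->.
have [f ->] := sect4_S1.
have h3 : sect r (ph ^+ 3) = sect r ph * g *+ 3.
  rewrite exprS ph2_diss phE diss_mul !sect_diss // g_diss.
  by case/orP: hr => /eqP -> /=; ring.
have [f1 h1] := sect_divph5 ph r5; have [f2 h2] := sect_divph5 (ph ^+ 3) r5.
have e1 : W ^+ 4 = ph * W ^+ 5 by rewrite [in RHS]exprS mulrA phW mul1r.
have e2' : W ^+ 2 = ph ^+ 3 * W ^+ 5 by rewrite (exprD W 3 2) mulrA (phWX 3 0) mul1r.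
have lin k1 k2 X1 X2 : sect r (b ^+ 2 * (a ^+ 3 * X1 - a * X2 *+ 2) *+ k1 + f *+ k2) =
    (E ^+ 2 * ph ^+ 3 * sect r X1 - E ^+ 2 * ph * sect r X2 *+ 2) *+ k1 + sect r f *+ k2.
  have -> : b ^+ 2 * (a ^+ 3 * X1 - a * X2 *+ 2) = dil5 (E ^+ 2 * ph ^+ 3) * X1 - dil5 (E ^+ 2 * ph) * X2 *+ 2.
    by rewrite (rmorphM dil5 _ (ph ^+ 3)) (rmorphM dil5 _ ph) !(rmorphXn dil5) /= -aE -bE; ring.
  move: (E ^+ 2 * ph ^+ 3) (E ^+ 2 * ph) => Y1 Y2.
  by rewrite sectD 2!sectMn sectB sectMn (sectM Y1) // (sectM Y2).
exists (E ^+ 2 * (ph ^+ 3 * f1 - ph * f2 *+ 2 - sect r ph * g * ph * (a * W ^+ 6)) + sect r f).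
apply: (etrans (lin _ _ _ _)); rewrite e1 e2' h1 h2 h3.
by rewrite gE; ring.
Qed.
End Quintic.

(** * Divisibility of the coefficients of E_2^3 / E_1^2 *)

Section Congruence.
Local Open Scope ring_scope.

Lemma cf_phi0 : cf phi 0 = 1.
Proof. by rewrite (cf_phi (leqnn 0)) /zrange /= big_seq1. Qed.

Lemma phi_unit : phi \is a GRing.unit.
Proof. exact: fps_unitE cf_phi0. Qed.

Lemma gfun_phi : gfun = dil2 euler ^+ 2 * phi^-1 ^+ 1.
Proof.
apply: (mulIr phi_unit); rewrite expr1 mulrVK ?phi_unit //.
apply: (mulIf dil2_euler_neq0); rewrite -mulrA phi_euler gfun_euler; ring.
Qed.

Lemma fraction_inj (R : idomainType) : injective (@FracField.tofrac R).
Proof. by move=> x y /eqP; rewrite tofrac_eq => /eqP. Qed.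

Lemma gfun_sect r : (r == 1%N) || (r == 4) ->
  exists f, sect r (sect 4 (sect 0 (sect 4 gfun))) = f *+ 125.
Proof.
move=> hr; have [U [V phE]] := phi_diss; have [J0 [J2 euE]] := euler_diss.
have an : dil5 phi * ((phi ^+ 2) ^+ 3 * (dil5 phi)^-1) = (phi ^+ 2) ^+ 3.
  by rewrite mulrC mulrVK // fps_unitE // cf_dil50 cf_phi0.
have := @sect_r_S1 phi euler cf_phi0 cf_euler0 phi_euler phi2_sect0 U V J0 J2 _ _ _ _ _ _ _
  erefl erefl erefl erefl erefl erefl erefl phE euE _ _ (@fraction_inj _) _ an _ (mulrV phi_unit)
  (fun j => sect 4 (dil2 euler ^+ 2 * phi^-1 ^+ j)) (fun=> erefl) r hr.
by rewrite -gfun_phi.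
Qed.

Lemma cf_gfun_dvd r k : (r == 1%N) || (r == 4) ->
  (125 %| cf gfun (625 * k + 125 * r + 104))%Z.
Proof.
move=> hr; have [f h] := gfun_sect hr; have := congr1 (cf^~ k) h; rewrite cfMn !cf_sect.
(* The four sections compose to the index 5 (5 (5 (5 k + r) + 4)) + 4. *)
rewrite (_ : 5 * _ + 4 = 625 * k + 125 * r + 104)%N; last by lia.
by move=> ->; apply/dvdzP; exists (cf f k); lia.
Qed.
End Congruence.

(** * Self-conjugate partitions and 1-shell totally symmetric plane partitions *)

Lemma card_ord_lt n k : k <= n -> #|[set i : 'I_n | i < k]| = k.
Proof.
move=> kn; rewrite -sum1_card (eq_bigl (fun i : 'I_n => i < k)) => [|i]; last by rewrite inE.
by rewrite -(big_ord_widen n (fun=> 1) kn) sum_nat_const card_ord muln1.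
Qed.

Lemma card_downclosed n (P : pred 'I_n) (i : 'I_n) :
  (forall j k : 'I_n, j <= k -> P k -> P j) -> (i < #|[set j | P j]|) = P i.
Proof.
move=> dP; apply/idP/idP => [|Pi].
  apply: contraLR => nPi; rewrite -leqNgt -(card_ord_lt (ltnW (ltn_ord i))).
  apply: subset_leq_card; apply/subsetP => j; rewrite !inE => Pj.
  by rewrite ltnNge; apply: contra nPi => ij; apply: dP Pj.
rewrite -[i.+1](card_ord_lt (ltn_ord i)); apply: subset_leq_card; apply/subsetP => j.
by rewrite !inE ltnS => ji; apply: dP Pi.
Qed.

(** * Principal hooks of self-conjugate partitions *)

Section Frobenius.
Variable n : nat.
Implicit Types (H : {set 'I_n}) (i j k d : nat).

(** The length of the d-th diagonal of the diagram, crossed once by each hook of arm at least d. *)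
Definition arms H d := #|[set h in H | d <= h]|.

(* The diagram of the self-conjugate partition whose principal hooks have arm lengths H. *)
Definition lam H i j := minn i j < arms H ((i - j) + (j - i)).

Lemma armsS H d : arms H d.+1 <= arms H d <= (arms H d.+1).+1.
Proof.
apply/andP; split.
  by apply: subset_leq_card; apply/subsetP => h; rewrite !inE => /andP[-> /ltnW].
case: (ltnP d n) => dn; last first.
  rewrite /arms (_ : [set h in H | d <= h] = set0) ?cards0 //.
  by apply/setP => h; rewrite !inE leqNgt (leq_trans (ltn_ord h) dn) andbF.
rewrite -add1n -(cards1 (Ordinal dn)); apply: leq_trans (leq_card_setU _ _).
apply: subset_leq_card; apply/subsetP => h; rewrite !inE => /andP[-> dh].
by rewrite -val_eqE /=; case: ltngtP dh.
Qed.

Lemma arms_mem H (h : 'I_n) : (h \in H) = (arms H h.+1 < arms H h).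
Proof.
apply/idP/idP => [hH|].
  apply: proper_card; apply/properP; split.
    by apply/subsetP => g; rewrite !inE => /andP[-> /ltnW].
  by exists h; rewrite !inE hH ?leqnn // ltnn.
apply: contraTT => hH; rewrite -leqNgt; apply: subset_leq_card; apply/subsetP => g.
rewrite !inE => /andP[gH hg]; rewrite gH ltn_neqAle hg andbT /=.
by apply: contraNneq hH => e; rewrite (_ : h = g) //; apply: val_inj.
Qed.

Lemma arms_le H d : arms H d <= n - d.
Proof.
case: (leqP d n) => dn; last first.
  rewrite /arms (_ : [set h in H | d <= h] = set0) ?cards0 //.
  by apply/setP => h; rewrite !inE leqNgt (leq_trans (ltn_ord h) (ltnW dn)) andbF.
have := cardsC [set h : 'I_n | h < d]; rewrite card_ord_lt // card_ord => e.
apply: (@leq_trans #|~: [set h : 'I_n | h < d]|); last by lia.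
by apply: subset_leq_card; apply/subsetP => h; rewrite !inE -leqNgt => /andP[_].
Qed.

Lemma lam_sym H i j : lam H i j = lam H j i.
Proof. by rewrite /lam minnC addnC. Qed.

Lemma lam_diag H i d : lam H i (d + i) = (i < arms H d).
Proof.
have e1 : minn i (d + i) = i by lia.
have e2 : i - (d + i) + (d + i - i) = d by lia.
by rewrite /lam e1 e2.
Qed.

(** By [armsS]: above the diagonal, a step down raises the minimum by one and [arms] by at most one;
    from the diagonal on, the minimum stays and [arms] cannot increase. *)
Lemma lamS H i j : lam H i.+1 j -> lam H i j.
Proof.
rewrite /lam; case: (ltnP i j) => ij.
  have -> : i - j + (j - i) = (i.+1 - j + (j - i.+1)).+1 by lia.
  by have := armsS H (i.+1 - j + (j - i.+1)); lia.
have -> : i.+1 - j + (j - i.+1) = (i - j + (j - i)).+1 by lia.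
by have := armsS H (i - j + (j - i)); lia.
Qed.

Lemma lam_down H i i' j : i' <= i -> lam H i j -> lam H i' j.
Proof.
move=> /subnKC <-; elim: (i - i') => [|k IH]; first by rewrite addn0.
by rewrite addnS => /lamS.
Qed.

Definition rowlen H i := #|[set k : 'I_n | lam H i k]|.

Lemma ltn_rowlen H i (k : 'I_n) : (k < rowlen H i) = lam H i k.
Proof.
apply: (@card_downclosed _ (fun k : 'I_n => lam H i k)) => j k' jk.
by rewrite !(lam_sym H i); apply: lam_down.
Qed.

Lemma rowlen_le H i : rowlen H i <= n.
Proof. by rewrite -[n in _ <= n]card_ord; apply: max_card. Qed.

Lemma sum_lt c : c <= n -> \sum_(i < n) (i < c) = c.
Proof. by move=> cn; rewrite -{2}(card_ord_lt cn) -sum1_card [RHS]big_mkcond; apply: eq_bigr => i _; rewrite inE; case: ifP. Qed.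

(** Counts cells by diagonals, which fit into the square by [arms_le]. *)
Lemma sum_lam_upper H : \sum_(i < n) \sum_(j < n | i <= j) lam H i j = \sum_(d < n) arms H d.
Proof.
have -> : \sum_(d < n) arms H d = \sum_(d < n) \sum_(i < n) (i < arms H d).
  by apply: eq_bigr => d _; rewrite sum_lt // (leq_trans (arms_le H d)) ?leq_subr.
rewrite exchange_big; apply: eq_bigr => i _ /=.
have -> : \sum_(j < n | i <= j) lam H i j = \sum_(0 + i <= j < n) lam H i j.
  by rewrite add0n (big_nat_widenl i 0) // big_mkord.
rewrite big_addn big_mkord (big_ord_widen n (fun d => lam H i (d + i) : nat)) ?leq_subr //.
rewrite big_mkcond; apply: eq_bigr => d _ /=.
rewrite lam_diag; case: ifP => // h; have := arms_le H d; have := ltn_ord i; lia.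
Qed.

Lemma sum_lam H : \sum_(i < n) \sum_(j < n) lam H i j + arms H 0 = 2 * \sum_(d < n) arms H d.
Proof.
have sp : \sum_(i < n) \sum_(j < n) lam H i j =
    \sum_(i < n) \sum_(j < n | i <= j) lam H i j + \sum_(i < n) \sum_(j < n | j < i) lam H i j.
  rewrite -big_split; apply: eq_bigr => i _ /=; rewrite (bigID (fun j : 'I_n => i <= j)) /=.
  by congr (_ + _); apply: eq_bigl => j; rewrite ltnNge.
have lo : \sum_(i < n) \sum_(j < n | j < i) lam H i j + arms H 0 = \sum_(i < n) \sum_(j < n | i <= j) lam H i j.
  rewrite (exchange_big_dep predT) //= -{1}(sum_lt (leq_trans (arms_le H 0) (leq_subr _ _))) -big_split.
  apply: eq_bigr => i _ /=; rewrite [RHS](bigD1 i) //= addnC; congr (_ + _).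
    by rewrite /lam minnn subnn.
  by apply: eq_big => [j|j _]; [rewrite ltn_neqAle andbC eq_sym | rewrite lam_sym].
by rewrite sp -addnA lo sum_lam_upper mul2n addnn.
Qed.

Lemma sum_arms H : \sum_(d < n) arms H d = \sum_(h in H) h.+1.
Proof.
have -> : \sum_(d < n) arms H d = \sum_(d < n) \sum_(h in H) (d <= h).
  apply: eq_bigr => d _; rewrite /arms -sum1_card big_mkcond [RHS]big_mkcond.
  by apply: eq_bigr => h _; rewrite inE; case: (h \in H) => //=; case: leqP.
rewrite exchange_big; apply: eq_bigr => h _ /=.
by rewrite -[RHS](sum_lt (ltn_ord h)); apply: eq_bigr => d _; rewrite ltnS.
Qed.

Lemma size_lam H : \sum_(i < n) \sum_(j < n) lam H i j = \sum_(h in H) (2 * h).+1.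
Proof.
have a0 : arms H 0 = \sum_(h in H) 1.
  by rewrite sum1_card /arms; congr #|pred_of_set _|; apply/setP => h; rewrite inE andbT.
have := sum_lam H; rewrite sum_arms a0 big_distrr /=.
have -> : \sum_(h in H) 2 * h.+1 = \sum_(h in H) (2 * h).+1 + \sum_(h in H) 1.
  by rewrite -big_split; apply: eq_bigr => h _ /=; lia.
by move/addIn.
Qed.
End Frobenius.

(** * Plane partitions built from a self-conjugate partition *)

Section ShellArray.
Variable m : nat.
Notation n := m.+1.
Implicit Types (H : {set 'I_n}) (A : pp_array n) (i j k : 'I_n).

(** The solid consists of three copies of the diagram, one in each coordinate plane; an interior
    entry only sees the copy at height 0. *)
Definition shell_entry H (i j : nat) : nat :=
  if i == 0 then rowlen H j else if j == 0 then rowlen H i else lam H i j.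

Definition shell_array H : pp_array n := \matrix_(i, j) inord (shell_entry H i j).

Lemma shell_arrayE H i j : shell_array H i j = shell_entry H i j :> nat.
Proof.
rewrite mxE inordK // ltnS /shell_entry; case: ifP => _; first exact: rowlen_le.
by case: ifP => _; [apply: rowlen_le | case: (lam _ _ _)].
Qed.

(** This symmetric description yields both monotonicity and total symmetry. *)
Lemma cube_shell H i j k : cube (shell_array H) i j k =
  [|| (i == 0 :> nat) && lam H j k, (j == 0 :> nat) && lam H i k | (k == 0 :> nat) && lam H i j].
Proof.
rewrite /cube shell_arrayE /shell_entry; case: eqP => i0.
  rewrite ltn_rowlen i0 /=; case L: (lam H j k) => //=; apply/esym/norP; split.
    by case: eqP => //= j0; rewrite -j0 L.
  by case: eqP => //= k0; rewrite lam_sym -k0 L.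
case: eqP => j0 /=; last by case: (lam H i j); case: (nat_of_ord k) => [|?].
rewrite ltn_rowlen j0; case L: (lam H i k) => //=.
by case: eqP => //= k0; rewrite -k0 L.
Qed.

Lemma leq_cube A B i j i' j' : (forall k, cube A i j k -> cube B i' j' k) -> A i j <= B i' j'.
Proof.
move=> h; rewrite leqNgt; apply/negP => lt.
have kn : B i' j' < n by apply: leq_trans lt _; rewrite -ltnS.
by have := h (Ordinal kn) lt; rewrite /cube /= ltnn.
Qed.

Lemma shell_array_plane H : plane_partition (shell_array H).
Proof.
apply/andP; split; apply/forallP => x; apply/forallP => y; apply/forallP => z; apply/implyP => le.
  apply: leq_cube => k; rewrite !cube_shell => /or3P[]/andP[/eqP e h]; apply/or3P.
  - by apply: Or31; rewrite h andbT; move: le; rewrite e; lia.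
  - by apply: Or32; rewrite e /=; apply: lam_down h.
  - by apply: Or33; rewrite e /=; apply: lam_down h.
apply: leq_cube => k; rewrite !cube_shell => /or3P[]/andP[/eqP e h]; apply/or3P.
- by apply: Or31; rewrite e /=; apply: lam_down h.
- by apply: Or32; rewrite h andbT; move: le; rewrite e; lia.
- by apply: Or33; rewrite e /= lam_sym; rewrite lam_sym in h; apply: lam_down h.
Qed.

Lemma shell_array_symmetric H : totally_symmetric (shell_array H).
Proof.
apply/forallP => i; apply/forallP => j; apply/forallP => k; rewrite !cube_shell.
rewrite (lam_sym H k i) (lam_sym H k j) (lam_sym H j i).
by case: (i == 0 :> nat); case: (j == 0 :> nat); case: (k == 0 :> nat);
  case: (lam H i j); case: (lam H i k); case: (lam H j k).
Qed.

Lemma shell_array_row H i j : i = 0 :> nat -> shell_array H i j = rowlen H j :> nat.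
Proof. by rewrite shell_arrayE /shell_entry => ->. Qed.

Lemma shell_array_col H i j : j = 0 :> nat -> shell_array H i j = rowlen H i :> nat.
Proof. by rewrite shell_arrayE /shell_entry => ->; case: eqP => [->|]. Qed.

Lemma shell_array_one_shell H : one_shell (shell_array H).
Proof.
have rl j : rowlen H j = #|[set k : 'I_n | j < rowlen H k]|.
  by congr #|pred_of_set _|; apply/setP => k; rewrite !inE ltn_rowlen lam_sym.
apply/and3P; split.
- apply/forallP => i; apply/implyP => /eqP i0; apply/forallP => j; apply/eqP.
  rewrite shell_array_row // rl; congr #|pred_of_set _|.
  by apply/setP => k; rewrite !inE shell_array_row.
- apply/forallP => j; apply/implyP => /eqP j0; apply/forallP => i; apply/eqP.
  rewrite shell_array_col // rl; congr #|pred_of_set _|.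
  by apply/setP => k; rewrite !inE shell_array_col.
- apply/forallP => i; apply/forallP => j; apply/implyP => /and3P[i0 j0].
  by rewrite shell_arrayE /shell_entry (gtn_eqF i0) (gtn_eqF j0); case: (lam _ _ _).
Qed.

(** Inclusion-exclusion on the three faces: they meet in pairs along axes of [rowlen H 0] cubes, and
    all three share the corner. The additive form avoids truncated subtraction. *)
Lemma shell_array_weight H :
  weight (shell_array H) + 3 * rowlen H 0 = 3 * \sum_(h in H) (2 * h).+1 + lam H 0 0.
Proof.
have rE (i : nat) : rowlen H i = \sum_(j < n) lam H i j.
  by rewrite /rowlen -sum1_card big_mkcond; apply: eq_bigr => j _; rewrite inE; case: ifP.
rewrite -size_lam /weight big_ord_recl.
have -> : \sum_(j < n) shell_array H ord0 j = \sum_(j < n) rowlen H j.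
  by apply: eq_bigr => j _; rewrite shell_array_row.
have -> : \sum_(i < n) \sum_(j < n) lam H i j = \sum_(i < n) rowlen H i by apply: eq_bigr => i _.
pose R := \sum_(i < m) rowlen H i.+1.
pose Q := \sum_(i < m) \sum_(j < m) lam H i.+1 j.+1.
have -> : \sum_(j < n) rowlen H j = rowlen H 0 + R by rewrite big_ord_recl.
have -> : \sum_(i < m) \sum_(j < n) shell_array H (lift ord0 i) j = R + Q.
  rewrite -big_split; apply: eq_bigr => i _; rewrite big_ord_recl /= shell_array_col //.
  by congr (_ + _); apply: eq_bigr => j _; rewrite shell_arrayE.
have RE : R + lam H 0 0 = rowlen H 0 + Q.
  have -> : rowlen H 0 = lam H 0 0 + \sum_(i < m) lam H i.+1 0.
    by rewrite rE big_ord_recl; congr (_ + _); apply: eq_bigr => i _; rewrite lam_sym.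
  rewrite -addnA -big_split addnC; congr (_ + _); apply: eq_bigr => i _.
  by rewrite rE big_ord_recl.
lia.
Qed.

Lemma lam_shell_array H i j : lam H i j = (0 < shell_array H i j).
Proof.
have -> : (0 < shell_array H i j) = cube (shell_array H) i j ord0 by [].
rewrite cube_shell /=; case L: (lam H i j); rewrite ?orbT ?orbF //; apply/esym/norP; split.
  by case: eqP => //= i0; rewrite lam_sym -i0 L.
by case: eqP => //= j0; rewrite -j0 L.
Qed.

(** The support gives [lam], its diagonals give [arms], and [arms] drops exactly at the elements of
    H. *)
Lemma shell_array_inj : injective shell_array.
Proof.
move=> H H' e.
have lamE i j : lam H i j = lam H' i j by rewrite !lam_shell_array e.
have armsE (G : {set 'I_n}) d : arms G d = \sum_(i < n) (d + i < n) && lam G i (d + i).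
  rewrite -{1}(@sum_lt n (arms G d)) ?(leq_trans (arms_le G d)) ?leq_subr //.
  apply: eq_bigr => i _; rewrite lam_diag.
  by have := arms_le G d; lia.
have ae d : arms H d = arms H' d.
  rewrite !armsE; apply: eq_bigr => i _; case: (ltnP (d + i) n) => //= h.
  by rewrite (lamE i (Ordinal h)).
by apply/setP => h; rewrite !arms_mem !ae.
Qed.

Section Inverse.
Variable A : pp_array n.
Hypotheses (ppA : plane_partition A) (tsA : totally_symmetric A) (osA : one_shell A).

Let r i : nat := A ord0 i.
(** The arm of the i-th principal hook is r i - i - 1, written additively. *)
Let H := [set h : 'I_n | [exists i : 'I_n, r i == i + h.+1]].

Lemma tsP i j k : [/\ cube A j i k = cube A i j k, cube A i k j = cube A i j k & cube A j k i = cube A i j k].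
Proof. by move/forallP: tsA => /(_ i) /forallP /(_ j) /forallP /(_ k) /and5P[/eqP ? /eqP ? _ /eqP ? _]. Qed.

(** Total symmetry carries the cube (0, i, j) to (i, j, 0). *)
Lemma row_cube i j : (j < r i) = (0 < A i j).
Proof. by have [_ _] := tsP ord0 i j; rewrite /cube => <-. Qed.

Lemma row_sym i j : (j < r i) = (i < r j).
Proof. by rewrite !row_cube; have [+ _ _] := tsP i j ord0; rewrite /cube => ->. Qed.

Lemma row_mono i j : i <= j -> r j <= r i.
Proof.
by move: ppA => /andP[_ /forallP /(_ ord0) /forallP /(_ i) /forallP /(_ j) /implyP h] ij; apply: h.
Qed.

Lemma row_le i : r i <= n.
Proof. by rewrite -ltnS; apply: ltn_ord. Qed.

(** The row lengths decrease weakly, so r i - i - 1 decreases strictly and distinct hooks have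
    distinct arms. *)
Lemma arms_row d : arms H d = #|[set i : 'I_n | d + i < r i]|.
Proof.
pose hook i : 'I_n := inord (r i - i.+1).
have hookE i : hook i = r i - i.+1 :> nat by rewrite inordK // ; have := row_le i; lia.
rewrite -(@card_in_imset _ _ hook) => [|i j]; last first.
  rewrite !inE => hi hj /(congr1 (@nat_of_ord _)); rewrite !hookE => e; apply: val_inj => /=.
  by case: (ltngtP i j) => // ij; have := row_mono (ltnW ij); lia.
congr #|pred_of_set _|; apply/setP => h; rewrite !inE; apply/andP/imsetP.
  move=> [/existsP[i /eqP e] dh]; exists i; first by rewrite inE; lia.
  by apply: ord_inj; rewrite hookE; lia.
move=> [i]; rewrite inE => hi ->; rewrite hookE; split; last by lia.
by apply/existsP; exists i; apply/eqP; lia.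
Qed.

Lemma lam_row i j : lam H i j = (j < r i).
Proof.
wlog ij : i j / i <= j => [h|].
  by case: (leqP i j) => ij; [apply: h | rewrite lam_sym row_sym; apply: h; apply: ltnW].
rewrite /lam (minn_idPl ij) (eqP (ij : i - j == 0)) add0n arms_row.
rewrite (@card_downclosed _ (fun k : 'I_n => j - i + k < r k)) ?subnK // => k l kl.
by have := row_mono kl; lia.
Qed.

Lemma shell_array_row_hooks : shell_array H = A.
Proof.
have rl i : rowlen H i = r i.
  rewrite -[RHS](card_ord_lt (row_le i)); congr #|pred_of_set _|.
  by apply/setP => k; rewrite !inE lam_row.
have col i : A i ord0 = r i :> nat.
  have e k : cube A i ord0 k = cube A ord0 i k by have [] := tsP ord0 i k.
  by apply/eqP; rewrite eqn_leq; apply/andP; split; apply: leq_cube => k; rewrite e.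
apply/matrixP => i j; apply: val_inj; rewrite /= shell_arrayE /shell_entry.
case: eqP => i0; first by rewrite rl (_ : i = ord0) //; apply: val_inj.
case: eqP => j0; first by rewrite rl (_ : j = ord0) //; apply: val_inj.
rewrite lam_row row_cube; have /and3P[_ _ /forallP /(_ i) /forallP /(_ j) /implyP h] := osA.
case: (posnP (A i j)) => [-> //|Aij]; have /eqP -> // : A i j == 1 :> nat.
by apply: h; apply/and3P; split; rewrite -?lt0n //; rewrite lt0n; apply/eqP.
Qed.
End Inverse.

Lemma f_card : f n = #|[set H : {set 'I_n} | weight (shell_array H) == n]|.
Proof.
rewrite -(card_imset _ shell_array_inj); congr #|pred_of_set _|; apply/setP => A.
rewrite !inE; apply/and4P/imsetP => [[pp ts os w]|[H]].
  by exists [set h : 'I_n | [exists i : 'I_n, A ord0 i == i + h.+1 :> nat]];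
    rewrite ?inE shell_array_row_hooks.
rewrite inE => w ->; split=> //.
- exact: shell_array_plane.
- exact: shell_array_symmetric.
- exact: shell_array_one_shell.
Qed.
End ShellArray.

(** * Counting by the largest hook *)

Section Counting.
Variable m : nat.
Notation n := m.+1.
Implicit Types (H J : {set 'I_n}) (M h : 'I_n).

Lemma lam00 H : lam H 0 0 = (H != set0).
Proof.
rewrite /lam /arms minnn card_gt0; congr (_ != _).
by apply/setP => h; rewrite !inE andbT.
Qed.

Definition is_top M H := (M \in H) && [forall h in H, h <= M].

Lemma is_topP M H : reflect (M \in H /\ forall h, h \in H -> h <= M) (is_top M H).
Proof. by apply: (iffP andP) => -[MH /'forall_implyP h]. Qed.

Lemma sum_is_top H : H != set0 -> \sum_M is_top M H = 1.
Proof.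
case/set0Pn => x xH; case: (@arg_maxnP _ x (mem H) val xH) => M MH Mmax.
have topM : is_top M H by apply/is_topP.
rewrite (bigD1 M) //= topM big1 // => h hM; case: is_topP => // -[hH hmax].
by case/eqP: hM; apply: val_inj; apply/eqP; rewrite eqn_leq (Mmax h hH : h <= M) hmax.
Qed.

Lemma rowlen_top M H : is_top M H -> rowlen H 0 = M.+1.
Proof.
move/is_topP => [MH Mmax]; rewrite -(card_ord_lt (ltn_ord M)); congr #|pred_of_set _|.
apply/setP => k; rewrite !inE /lam min0n sub0n subn0 add0n card_gt0 ltnS.
apply/set0Pn/idP => [[h]|kM]; last by exists M; rewrite inE MH.
by rewrite inE => /andP[/Mmax hM kh]; apply: leq_trans hM.
Qed.

Lemma sum_top M H : is_top M H ->
  \sum_(h in H) (2 * h).+1 = (2 * M).+1 + \sum_(h in H | h < M) (2 * h).+1.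
Proof.
move/is_topP => [MH Mmax]; rewrite (bigD1 M) //=; congr (_ + _); apply: eq_bigl => h.
by case hH: (h \in H) => //=; rewrite ltn_neqAle (Mmax h hH) andbT.
Qed.

(** The first row has M + 1 cells, so with S the sum over the smaller hooks the weight is 3 (2 M + 1
    + S) - 3 (M + 1) + 1 = 3 (M + S) + 1. *)
Lemma weight_top M H s : n = (3 * s).+1 -> is_top M H ->
  (weight (shell_array H) == n) = (M + \sum_(h in H | h < M) (2 * h).+1 == s).
Proof.
move=> ns tM; have := shell_array_weight H; rewrite (rowlen_top tM) (sum_top tM) lam00.
have -> : H != set0 by case/is_topP: tM => MH _; apply/set0Pn; exists M.
by move: (weight _) (\sum_(_ in _ | _) _) => w S; lia.
Qed.

Lemma weight_nonempty H : weight (shell_array H) == n -> (H != set0) && (n %% 3 == 1).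
Proof.
move/eqP => w; have := shell_array_weight H; rewrite w lam00; case: eqP => [->|_] /=.
  by rewrite big_set0; lia.
by move=> e; lia.
Qed.

Lemma f_eq0 : n %% 3 != 1 -> f n = 0.
Proof.
move=> n3; rewrite f_card; apply/eqP; rewrite cards_eq0; apply/eqP/setP => H; rewrite !inE.
by apply/negP => /weight_nonempty/andP[_ e]; rewrite e in n3.
Qed.

Lemma f_sum s : n = (3 * s).+1 ->
  f n = \sum_M \sum_H (is_top M H && (M + \sum_(h in H | h < M) (2 * h).+1 == s)).
Proof.
move=> ns; rewrite f_card -sum1_card big_mkcond exchange_big /=; apply: eq_bigr => H _; rewrite inE.
case: ifP => w.
  have /andP[H0 _] := weight_nonempty w; transitivity (\sum_M is_top M H); first by rewrite sum_is_top.
  by apply: eq_bigr => M _; case t: (is_top M H) => //; rewrite andTb -(weight_top ns t) w.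
by rewrite big1 // => M _; case t: (is_top M H) => //; rewrite andTb -(weight_top ns t) w.
Qed.

Local Open Scope ring_scope.

Lemma qoddp_top M : qoddp M = \sum_H (if is_top M H then q ^+ (\sum_(h in H | (h < M)%N) (2 * h).+1) else 0).
Proof.
(* F weighs the membership of h and G its absence: free below M, with M forced in and larger
   elements forced out. *)
pose F h : fps := if (h < M)%N then q ^+ (2 * h).+1 else (h == M)%:R.
pose G h : fps := (h != M)%:R.
have -> : qoddp M = \prod_(h < n) (F h + G h).
  rewrite /qoddp (big_ord_widen n (fun i => 1 + q ^+ (2 * i).+1) (ltnW (ltn_ord M))) big_mkcond.
  apply: eq_bigr => h _; rewrite /F /G -val_eqE /=.
  by case: ltngtP => _; rewrite ?addr0 ?add0r // addrC.
rewrite bigA_distr; apply: eq_bigr => H _; case: ifP => [/is_topP[MH Mmax]|].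
  rewrite -prodrXr [RHS]big_mkcond /=; apply: eq_bigr => h _; rewrite /F /G.
  case hH: (h \in H) => /=.
    by have := Mmax h hH; rewrite -val_eqE /=; case: ltngtP.
  by rewrite (_ : h != M) //; apply: contraFneq hH => ->.
move/negbT; rewrite negb_and => /orP[MH|].
  by rewrite (bigD1 M) //= (negbTE MH) /G eqxx mul0r.
rewrite negb_forall => /existsP[h]; rewrite negb_imply -ltnNge => /andP[hH Mh].
rewrite (bigD1 h) //= hH /F ltnNge (ltnW Mh) /= -val_eqE (gtn_eqF Mh) mul0r //.
Qed.

Lemma f_shell s : n = (3 * s).+1 -> (f n)%:Z = cf shell s.
Proof.
move=> ns; rewrite (f_sum ns) (cf_fsum shell_summable (N := n)); last by rewrite ns; lia.
rewrite -natz natr_sum; apply: eq_bigr => M _; rewrite qoddp_top mulr_sumr cf_sum natr_sum.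
apply: eq_bigr => H _; case: ifP => _; last by rewrite mulr0.
by rewrite -exprD cf_qX andTb eq_sym.
Qed.
End Counting.

Theorem theorem1p1 (n : nat) :
  f (1250 * n + 125) = 0 %[mod 125] /\ f (1250 * n + 1125) = 0 %[mod 125].
Proof.
have key N r k : ((r == 1) || (r == 4))%N -> N = 6 * (625 * k + 125 * r + 104) + 1 ->
    f N = 0 %[mod 125].
  move=> hr NE; have := cf_gfun_dvd k hr; rewrite -cf_shell_even.
  rewrite -(@f_shell (6 * (625 * k + 125 * r + 104))) /=; last by lia.
  by rewrite -[_.+1]addn1 -NE dvdzE /= mod0n => /eqP.
have zero N : 0 < N -> N %% 3 != 1 -> f N = 0 %[mod 125].
  by case: N => // N _ N3; rewrite f_eq0.
split.
  (* The residue is 1 exactly for n = 3 k + 1, and then the argument is 6 (625 k + 125 + 104) +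
     1. *)
  case: (boolP ((1250 * n + 125) %% 3 == 1)) => h; last by apply: zero => //; lia.
  by apply: (key _ 1 (n %/ 3)) => //; lia.
(* Here n = 3 k + 2, and the argument is 6 (625 k + 500 + 104) + 1. *)
case: (boolP ((1250 * n + 1125) %% 3 == 1)) => h; last by apply: zero => //; lia.
by apply: (key _ 4 (n %/ 3)) => //; lia.
Qed.
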